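(* Let $Y=(Y^1,\ldots,Y^d)$ be the multivariate fractional Ornstein--Uhlenbeck process with parameters $\alpha_i,\nu_i>0$, $H_i\in(0,1)\setminus\{1/2\}$, $\rho_{ij},\eta_{ij}$. Then $Y$ is cross-covariance ergodic, i.e. for all $\tau\in\mathbb{R}$ and $i,j\in\{1,\dots,d\}$, $i\neq j$, $$\frac1{2T}\int_{-T}^TY^i_{t+\tau}Y^j_t\,dt\longrightarrow\mathbb{E}[Y^i_\tau Y^j_0]\quad\text{in probability, as }T\to\infty.$$
   Context: Let $d\in\mathbb{N}$, $H_1,\dots,H_d\in(0,1)\setminus\{1/2\}$, $H_{ij}=H_i+H_j$. A $d$-variate fractional Brownian motion is a centered Gaussian process $(B^{H_1}_t,\dots,B^{H_d}_t)_{t\in\mathbb{R}}$ in $\mathbb{R}^d$ (taken with continuous paths) such that each $B^{H_i}$ is a fractional Brownian motion with Hurst index $H_i$; for every $\lambda>0$, $(B^{H_1}_{\lambda t},\dots,B^{H_d}_{\lambda t})_{t}$ and $(\lambda^{H_1}B^{H_1}_t,\dots,\lambda^{H_d}B^{H_d}_t)_{t}$ have the same finite-dimensional distributions; and it has stationary increments. We normalize $\mathrm{Var}(B^{H_i}_1)=1$. For $i\ne j$ there are then (known fact) $\rho_{ij}=\rho_{ji}\in[-1,1]$, $\eta_{ij}=-\eta_{ji}\in\mathbb{R}$ with $\rho_{ij}=\mathrm{Corr}(B_1^{H_i},B_1^{H_j})$ and, for $t,s\in\mathbb{R}$: if $H_{ij}\ne1$, $$\mathrm{Cov}(B^{H_i}_t,B^{H_j}_s)=\tfrac12\big((\rho_{ij}+\mathrm{sign}(t)\eta_{ij})|t|^{H_{ij}}+(\rho_{ij}-\mathrm{sign}(s)\eta_{ij})|s|^{H_{ij}}-(\rho_{ij}-\mathrm{sign}(s-t)\eta_{ij})|s-t|^{H_{ij}}\big);$$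 if $H_{ij}=1$, $$\mathrm{Cov}(B^{H_i}_t,B^{H_j}_s)=\tfrac12\big(\rho_{ij}(|s|+|t|-|s-t|)+\eta_{ij}(s\log|s|-t\log|t|-(s-t)\log|s-t|)\big),$$ where $\mathrm{sign}(x)=1$ for $x\ge0$, $-1$ for $x<0$, and $0\log0=0$. For $\alpha_i,\nu_i>0$, the multivariate fractional Ornstein--Uhlenbeck process $Y=(Y^1_t,\dots,Y^d_t)_{t\in\mathbb{R}}$ is $$Y^i_t=\nu_i\int_{-\infty}^te^{-\alpha_i(t-u)}dB^{H_i}_u,\quad i=1,\dots,d,$$ with pathwise Riemann--Stieltjes integrals, i.e. $Y^i_t=\nu_i\big(B^{H_i}_t-\alpha_i\int_{-\infty}^tB^{H_i}_ue^{-\alpha_i(t-u)}du\big)$ almost surely. It is a centered process: $\mathbb{E}[Y^i_t]=0$. *)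

(* Defs.v *)
From mathcomp Require Import all_boot all_order all_algebra.
From mathcomp Require Import all_classical all_reals all_analysis.

Set Implicit Arguments.
Unset Strict Implicit.
Unset Printing Implicit Defensive.

Import Order.TTheory GRing.Theory Num.Theory.
Import numFieldNormedType.Exports.

Local Open Scope classical_set_scope.
Local Open Scope ring_scope.

Section processes.
Context {dO : measure_display} {Omega : measurableType dO} {R : realType}.
Variable P : probability Omega R.

(* [normal_prob m 0] is the uniform law on [0, 1], not the point mass at [m],
   so degenerate Gaussian laws are listed separately. *)
Definition gaussian_rv (X : Omega -> R) : Prop :=
  measurable_fun setT X /\
  ((exists m s : R, 0 < s /\ forall A : set R, measurable A ->
      P (X @^-1` A) = normal_prob m s A) \/
   (exists m : R, forall A : set R, measurable A ->
      P (X @^-1` A) = dirac m A)).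

Definition centered_gaussian_process (I : Type) (X : I -> Omega -> R) : Prop :=
  (forall (n : nat) (t : 'I_n -> I) (c : 'I_n -> R),
     gaussian_rv (fun w => \sum_(k < n) c k * X (t k) w)) /\
  (forall t : I, ('E_P[X t] = 0)%E).

Definition same_fdd (I : Type) (X X' : I -> Omega -> R) : Prop :=
  forall (n : nat) (t : 'I_n -> I) (A : set (n.-tuple R)), measurable A ->
    P [set w | A [tuple X (t k) w | k < n]] =
    P [set w | A [tuple X' (t k) w | k < n]].

Definition is_fbm (H : R) (X : R -> Omega -> R) : Prop :=
  centered_gaussian_process X /\
  forall t s : R, covariance P (X t) (X s) =
    ('V_P[X 1%R] *
     (2^-1 * (`|t| `^ (2 * H) + `|s| `^ (2 * H) - `|t - s| `^ (2 * H)))%:E)%E.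

Record is_mfbm (d : nat) (H : 'I_d -> R) (B : 'I_d -> R -> Omega -> R) : Prop :=
  IsMfbm {
  mfbm_gaussian :
    centered_gaussian_process (fun p : 'I_d * R => B p.1 p.2);
  mfbm_continuous :
    forall (i : 'I_d) (w : Omega), continuous (fun t : R => B i t w);
  mfbm_marginal : forall i : 'I_d, is_fbm (H i) (B i);
  mfbm_self_similar : forall l : R, 0 < l ->
    same_fdd (fun (p : 'I_d * R) w => B p.1 (l * p.2) w)
             (fun (p : 'I_d * R) w => l `^ H p.1 * B p.1 p.2 w);
  mfbm_stationary_increments : forall h : R,
    same_fdd (fun (p : 'I_d * R) w => B p.1 (p.2 + h) w - B p.1 h w)
             (fun (p : 'I_d * R) w => B p.1 p.2 w - B p.1 0 w) }.

Definition correlation (X Y : Omega -> R) : R :=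
  fine (covariance P X Y) / Num.sqrt (fine ('V_P[X])%E * fine ('V_P[Y])%E).

(* unlike [Num.sg], equal to 1 at 0 *)
Definition sign (x : R) : R := if 0 <= x then 1 else -1.

(* [ln 0 = 0] in the library, so [0 * ln `|0| = 0] as required *)
Definition mfbm_cross_cov (h rho eta t s : R) : R :=
  if h == 1 then
    2^-1 * (rho * (`|s| + `|t| - `|s - t|) +
            eta * (s * ln `|s| - t * ln `|t| - (s - t) * ln `|s - t|))
  else
    2^-1 * ((rho + sign t * eta) * `|t| `^ h
            + (rho - sign s * eta) * `|s| `^ h
            - (rho - sign (s - t) * eta) * `|s - t| `^ h).

Record mfbm_parameters (d : nat) (H : 'I_d -> R) (B : 'I_d -> R -> Omega -> R)
    (rho eta : 'I_d -> 'I_d -> R) : Prop := MfbmParameters {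
  rho_sym : forall i j : 'I_d, i != j -> rho i j = rho j i;
  rho_bound : forall i j : 'I_d, i != j -> -1 <= rho i j <= 1;
  rho_corr : forall i j : 'I_d, i != j ->
    rho i j = correlation (B i 1) (B j 1);
  eta_antisym : forall i j : 'I_d, i != j -> eta i j = - eta j i;
  mfbm_covE : forall i j : 'I_d, i != j -> forall t s : R,
    covariance P (B i t) (B j s) =
    (mfbm_cross_cov (H i + H j) (rho i j) (eta i j) t s)%:E }.

Definition cvg_in_probability (I : Type) (F : set_system I)
    (X : I -> Omega -> R) (c : R) : Prop :=
  (forall x : I, measurable_fun setT (X x)) /\
  forall e : R, 0 < e -> P [set w | e <= `|X x w - c|] @[x --> F] --> 0%E.

End processes.

Section riemann_stieltjes.
Context {R : realType}.
Implicit Types (f g : R -> R) (a b : R).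

(* The subdivision is a = x_0 < x_1 < ... < x_n = b with s = [:: x_1; ...; x_n];
   the tag c k lies in [x_k, x_(k+1)]. *)
Definition RS_sum f g a (s : seq R) (c : nat -> R) : R :=
  \sum_(k < size s) f (c k) * (g (nth a s k) - g (nth a (a :: s) k)).

Definition is_RS_integral f g a b (l : R) : Prop :=
  forall e : R, 0 < e -> exists2 delta : R, 0 < delta &
    forall (s : seq R) (c : nat -> R), itv_partition a b s ->
      (forall k : nat, (k < size s)%N ->
         nth a (a :: s) k <= c k <= nth a s k /\
         nth a s k - nth a (a :: s) k < delta) ->
      `|RS_sum f g a s c - l| < e.

(* 0 if the integral does not exist *)
Definition RS_integral f g a b : R := xget 0 [set l | is_RS_integral f g a b l].

Definition RS_integral_Ny f g b : R :=
  lim (RS_integral f g a b @[a --> -oo]).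

End riemann_stieltjes.

Section fractional_Ornstein_Uhlenbeck.
Context {dO : measure_display} {Omega : measurableType dO} {R : realType}.

Definition mfou (d : nat) (alpha nu : 'I_d -> R) (B : 'I_d -> R -> Omega -> R)
    (i : 'I_d) (t : R) (w : Omega) : R :=
  nu i * RS_integral_Ny (fun u => expR (- alpha i * (t - u)))
                        (fun u => B i u w) t.

Definition cross_time_average (d : nat) (Y : 'I_d -> R -> Omega -> R)
    (tau : R) (i j : 'I_d) (T : R) (w : Omega) : R :=
  (2 * T)^-1 *
  Rintegral lebesgue_measure `[- T, T] (fun t : R => Y i (t + tau) w * Y j t w).

End fractional_Ornstein_Uhlenbeck.

(* Main.v *)
From HB Require Import structures.
Require Import Defs.
From mathcomp Require Import all_boot all_order all_algebra.
From mathcomp Require Import all_classical all_reals all_analysis.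
From mathcomp Require Import measurable_realfun ring lra.
Import Order.TTheory GRing.Theory Num.Theory.
Import numFieldNormedType.Exports.
Local Open Scope classical_set_scope.
Local Open Scope ring_scope.

Set Implicit Arguments.
Unset Strict Implicit.
Unset Printing Implicit Defensive.

(** The averages converge in mean square, because the two coordinates taken at a
    late time are nearly uncorrelated with the same coordinates taken much
    earlier.

    Integration by parts writes the value of a unit-volatility coordinate at time
    [t] as the mean of the increment [b t - b (t - v)] of its driving path over an
    exponentially distributed lag [v] ([RS_integral_Ny_exp_law]). This needs
    paths of polynomial growth, which a chaining argument provides almost surely
    ([ae_growth]). Rescaling time by [T] and averaging over a uniform time in
    [-1 <= r <= 1] and over the two independent lags, the time average becomes the mean
    of a product of two increments under a law that does not depend on [T]
    ([ae_mean_increment_product], [time_average_unif]).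

    The second moment of the centered mean is the mean, over pairs of sample
    points, of the covariances between the products ([second_moment_integral]).
    By Isserlis' formula ([wick]) such a covariance is a combination of two
    products of covariances of increments ([pair_correlation]), and the covariance
    of two increments is a second difference of a function of their time lag
    ([incr_cov]). On each half-line that function is a multiple of [|x| `^ h] with
    [h < 2], or of [x * ln |x|], plus a linear term; so its second derivative tends
    to [0] at infinity, and so do its second differences ([lag_cov_vanish]). Two
    sample points with different rescaled times [r] and [r'] are at distance
    [T * |r - r'|], which is large; points with the same time form a null set.
    Dominated convergence ([mean_square_cvg0]) and Chebyshev's inequality
    conclude. *)

(** * Integrable real functions *)

Section Rintegrable.
Context d (T : measurableType d) (R : realType) (mu : {measure set T -> \bar R}).
Implicit Types (f g : T -> R) (D : set T).

Lemma RintegrableZl D (k : R) f : measurable D -> mu.-integrable D (EFin \o f) ->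
  mu.-integrable D (EFin \o (fun x => k * f x)).
Proof.
move=> mD fi; apply: (eq_integrable mD (fun x => k%:E * (f x)%:E)%E) => //.
exact: integrableZl.
Qed.

Lemma RintegrableD D f g : measurable D -> mu.-integrable D (EFin \o f) ->
  mu.-integrable D (EFin \o g) -> mu.-integrable D (EFin \o (fun x => f x + g x)).
Proof.
move=> mD fi gi; apply: (eq_integrable mD ((EFin \o f) \+ (EFin \o g))%E) => //.
exact: integrableD.
Qed.

Lemma RintegrableB D f g : measurable D -> mu.-integrable D (EFin \o f) ->
  mu.-integrable D (EFin \o g) -> mu.-integrable D (EFin \o (fun x => f x - g x)).
Proof.
move=> mD fi gi; apply: (eq_integrable mD ((EFin \o f) \- (EFin \o g))%E) => //.
exact: integrableB.
Qed.

Lemma le_Rintegrable D f g : measurable D -> measurable_fun D f ->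
  (forall x, D x -> `|f x| <= g x) -> mu.-integrable D (EFin \o g) ->
  mu.-integrable D (EFin \o f).
Proof.
move=> mD mf fg; apply: le_integrable => //; first exact/measurable_EFinP.
by move=> x Dx; rewrite /= lee_fin (le_trans (fg _ Dx))// ler_norm.
Qed.

End Rintegrable.

(** * Generating functions of normal laws *)

Section density.
Context d (T : measurableType d) (R : realType).
Variables (nu : {finite_measure set T -> \bar R}).
Variables (mu : {sigma_finite_measure set T -> \bar R}) (g : T -> R).
Hypothesis gi : mu.-integrable setT (EFin \o g).
Hypothesis nuE : forall A, measurable A -> nu A = (\int[mu]_(x in A) (g x)%:E)%E.

Let mg : measurable_fun setT (EFin \o g). Proof. exact: measurable_int gi. Qed.

Let dom : nu `<< mu.
Proof.
apply/null_content_dominatesP => A mA muA0; rewrite nuE//.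
by apply: null_set_integral => //; exact: measurable_funTS.
Qed.

(** A density is a version of the Radon-Nikodym derivative, so the general change
    of variables applies to it. *)
Lemma ge0_integral_density (f : T -> \bar R) :
  measurable_fun setT f -> (forall x, 0 <= f x)%E ->
  (\int[nu]_x f x = \int[mu]_x (f x * (g x)%:E))%E.
Proof.
move=> mf f0.
rewrite -(Radon_Nikodym_SigmaFinite.change_of_variables dom f0)//.
have irn := Radon_Nikodym_SigmaFinite.f_integrable dom.
apply: ae_eq_integral => //.
- by apply: emeasurable_funM => //; exact: (measurable_int _ irn).
- exact: emeasurable_funM.
apply: ae_eqe_mul2l; apply: integral_ae_eq => // A _ mA.
by rewrite -Radon_Nikodym_SigmaFinite.f_integral// -nuE.
Qed.

Lemma integral_density (f : T -> R) : nu.-integrable setT (EFin \o f) ->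
  (\int[nu]_x (f x)%:E = \int[mu]_x (f x * g x)%:E)%E.
Proof.
move=> fi.
rewrite -(Radon_Nikodym_change_of_variables dom measurableT fi).
have mf := measurable_int _ fi.
have irn := Radon_Nikodym_SigmaFinite.f_integrable dom.
apply: ae_eq_integral => //.
- by apply: emeasurable_funM => //; exact: measurable_int (Radon_Nikodym_integrable _).
- by under eq_fun do rewrite EFinM; exact: emeasurable_funM.
under [X in ae_eq _ _ _ X]eq_fun do rewrite EFinM.
apply: ae_eqe_mul2l; apply: ae_eq_trans.
  exact/ae_eq_sym/(ae_eq_Radon_Nikodym_SigmaFinite dom measurableT).
apply: integral_ae_eq => // A _ mA.
by rewrite -Radon_Nikodym_SigmaFinite.f_integral// -nuE.
Qed.

End density.

(** Completing the square: tilting a normal density by an exponential gives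
    another normal density, so the moment generating function only needs the
    total mass of the latter. *)
Lemma normal_mgf (R : realType) (m s theta : R) : s != 0 ->
  (\int[normal_prob m s]_x (expR (theta * x))%:E =
   (expR (m * theta + s ^+ 2 * theta ^+ 2 / 2))%:E)%E.
Proof.
move=> s0; rewrite (ge0_integral_density (integrable_normal_pdf m s))//; last first.
  by apply/measurable_EFinP/measurableT_comp => //; exact: mulrl_measurable.
under eq_integral => x _.
  rewrite -EFinM (_ : expR _ * _ = expR (m * theta + s ^+ 2 * theta ^+ 2 / 2) *
    normal_pdf (m + s ^+ 2 * theta) s x); last first.
    rewrite !normal_pdfE//= /normal_fun [LHS]mulrCA [RHS]mulrCA -!expRD.
    congr (_ * expR _); field; exact: s0.
  rewrite EFinM.
over.
rewrite ge0_integralZl//; first by rewrite integral_normal_pdf mule1.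
- by apply/measurable_EFinP; apply: measurable_normal_pdf.
- by move=> x _; rewrite lee_fin normal_pdf_ge0.
Qed.

Section gaussian.
Context {dO : measure_display} {Omega : measurableType dO} {R : realType}.
Variable P : probability Omega R.

(** A point mass has the generating function of a normal law of variance [0], so
    that degenerate Gaussian variables need no separate treatment afterwards. *)
Lemma gaussian_rv_mgf (X : Omega -> R) : gaussian_rv P X ->
  exists m v : R, 0 <= v /\ forall theta : R,
   (\int[P]_w (expR (theta * X w))%:E =
   (expR (m * theta + v * theta ^+ 2 / 2))%:E)%E.
Proof.
move=> [mX laws].
pose X' : {mfun Omega >-> measurableTypeR R} :=
  HB.pack X (isMeasurableFun.Build _ _ Omega (measurableTypeR R) X mX).
have mexp theta : measurable_fun setT (fun x : R => (expR (theta * x))%:E).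
  by apply/measurable_EFinP/measurableT_comp => //; exact: mulrl_measurable.
have E theta : (\int[P]_w (expR (theta * X w))%:E =
    \int[distribution P X']_x (expR (theta * x))%:E)%E.
  rewrite ge0_integral_distribution//; first exact: mexp.
case: laws => [[m [s [s0 lawX]]]|[m lawX]].
  exists m, (s ^+ 2); split; first exact: sqr_ge0.
  move=> theta; rewrite E -normal_mgf ?gt_eqF//.
  by apply: eq_measure_integral => A mA _; exact: lawX.
exists m, 0; split=> // theta; rewrite E (eq_measure_integral (@dirac _ (measurableTypeR R) m R)).
  rewrite integral_dirac//; last exact: mexp.
  by rewrite diracT mul1e !mul0r addr0 mulrC.
by move=> A mA _; exact: lawX.
Qed.

End gaussian.

(** * Moments from the generating function *)

(** Since [n! * j!] is at most [(n + j)!], the tail of the series is bounded term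
    by term by [|y| ^+ n / n!] times the series of [expR |y|]. *)
Lemma expR_taylor_le (R : realType) (y : R) (n : nat) :
  `|expR y - \sum_(k < n) y ^+ k / k`!%:R| <= `|y| ^+ n / n`!%:R * expR `|y|.
Proof.
have cs : (series (exp_coeff y) @ \oo --> expR y).
  exact: is_cvg_series_exp_coeff.
have cn : (fun N => `|series (exp_coeff y) N - \sum_(k < n) y ^+ k / k`!%:R|) @ \oo
    --> `|expR y - \sum_(k < n) y ^+ k / k`!%:R|.
  by apply: cvg_norm; apply: cvgB => //; exact: cvg_cst.
rewrite -(cvg_lim _ cn)//; apply: limr_le; first by apply/cvg_ex; eexists; exact: cn.
near=> N.
have nN : (n <= N)%N by near: N; exact: nbhs_infty_ge.
rewrite /series/= -(big_mkord xpredT (fun k => y ^+ k / k`!%:R)).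
rewrite (big_cat_nat (leq0n n) nN)//= addrAC subrr add0r.
apply: (le_trans (ler_norm_sum _ _ _)).
rewrite -{1}(add0n n) big_addn.
apply: (@le_trans _ _ (`|y| ^+ n / n`!%:R * \sum_(0 <= j < (N - n)%N) `|y| ^+ j / j`!%:R)).
  rewrite mulr_sumr; apply: ler_sum => j _.
  rewrite normrM normrX normfV normr_nat [(j + n)%N]addnC exprD.
  rewrite mulrACA ler_wpM2l// -?invfM ?mulr_ge0// lef_pV2 ?posrE ?mulr_gt0 ?ltr0n ?fact_gt0//.
  rewrite -natrM ler_nat -(bin_fact (leq_addr j n)) addKn mulnC.
  by rewrite -[leqLHS]mul1n leq_mul// bin_gt0 leq_addr.
rewrite ler_wpM2l// ?mulr_ge0//.
have -> : \sum_(0 <= j < (N - n)%N) `|y| ^+ j / j`!%:R =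
    series (exp_coeff `|y|) (N - n)%N by [].
have mono : {homo series (exp_coeff `|y|) : a b / (a <= b)%N >-> a <= b}.
  by apply/nondecreasing_series => k _ _; exact: exp_coeff_ge0.
exact: nondecreasing_cvgn_le mono (is_cvg_series_exp_coeff _) _.
Unshelve. all: by end_near. Qed.

Lemma le_linear_eq0 (R : realFieldType) (a K : R) :
  (forall t, 0 < t <= 1 -> `|a| <= K * t) -> a = 0.
Proof.
move=> h; apply/eqP; apply: contraT => a0.
have a1 : 0 < `|a| by rewrite normr_gt0.
have K0 : 0 <= K by have := h 1; rewrite ltr01 lexx mulr1 => /(_ isT); lra.
have d0 : 0 < `|a| + K + 1 by lra.
have := h (`|a| / (`|a| + K + 1)).
rewrite divr_gt0//= ler_pdivrMr// mul1r.
have -> : `|a| <= `|a| + K + 1 by lra.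
move=> /(_ isT); rewrite mulrA ler_pdivlMr//; nra.
Qed.

(** Identification of the first two Taylor coefficients from a remainder of order
    three. *)
Lemma quad_coeff_eq0 (R : realFieldType) (a b K : R) :
  (forall t, 0 < t <= 1 -> `|a * t + b * t ^+ 2| <= K * t ^+ 3) -> a = 0 /\ b = 0.
Proof.
move=> h.
have a0 : a = 0.
  apply: (@le_linear_eq0 _ _ (`|b| + `|K|)) => t /[dup] /h ht /andP[t0 t1].
  rewrite -(ler_pM2r t0) -{1}(gtr0_norm t0) -normrM.
  have -> : a * t = (a * t + b * t ^+ 2) - b * t ^+ 2 by ring.
  rewrite (le_trans (ler_normB _ _))// normrM (gtr0_norm (exprn_gt0 2 t0)).
  rewrite -[leRHS]mulrA -expr2 mulrDl [leRHS]addrC lerD// (le_trans ht)//.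
  apply: (@le_trans _ _ (`|K| * t ^+ 3)).
    by rewrite ler_wpM2r ?ler_norm// exprn_ge0// ltW.
  by rewrite ler_wpM2l// ler_wiXn2l// ?ltW.
split => //; apply: (@le_linear_eq0 _ _ K) => t /[dup] /h ht /andP[t0 t1].
move: ht; rewrite a0 mul0r add0r normrM (gtr0_norm (exprn_gt0 2 t0)).
have -> : K * t ^+ 3 = K * t * t ^+ 2 by ring.
by rewrite ler_pM2r// exprn_gt0.
Qed.

Section mgf_moments.
Context {dO : measure_display} {Omega : measurableType dO} {R : realType}.
Variable P : probability Omega R.
Variables (X : Omega -> R) (mX : measurable_fun setT X).

(** The left-hand side is one term of the series of [expR (theta * |x|)], and [|x|]
    is [x] or [- x]. *)
Lemma normX_le_expR (x theta : R) (n : nat) : 0 < theta ->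
  `|x| ^+ n <= n`!%:R / theta ^+ n * (expR (theta * x) + expR (- theta * x)).
Proof.
move=> t0; rewrite mulrAC ler_pdivlMr ?exprn_gt0// -exprMn.
rewrite -ler_pdivrMl ?ltr0n ?fact_gt0// mulrC.
have y0 : 0 <= `|x| * theta by rewrite mulr_ge0// ltW.
apply: (@le_trans _ _ (expR (`|x| * theta))).
  have := expR_taylor_le (`|x| * theta) 0; rewrite big_ord0.
  have mono : {homo series (exp_coeff (`|x| * theta)) : a b / (a <= b)%N >-> a <= b}.
    by apply/nondecreasing_series => k _ _; exact: exp_coeff_ge0.
  move=> _; apply: le_trans (nondecreasing_cvgn_le mono (is_cvg_series_exp_coeff _) n.+1).
  rewrite /series/= big_nat_recr//= lerDr sumr_ge0// => k _.
  exact: exp_coeff_ge0.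
have [x0|x0] := ger0P x.
  by rewrite [x * _]mulrC lerDl expR_ge0.
by rewrite [- x * _]mulrC mulrN mulNr lerDr expR_ge0.
Qed.

Hypothesis iexp : forall theta,
  P.-integrable setT (EFin \o (fun w => expR (theta * X w))).

Lemma mgf_integrableX (n : nat) : P.-integrable setT (EFin \o (fun w => X w ^+ n)).
Proof.
apply: (le_Rintegrable measurableT
   (g := fun w => n`!%:R * (expR (1 * X w) + expR (- 1 * X w)))).
- exact: measurable_funX.
- move=> w _; rewrite normrX.
  by have := normX_le_expR (X w) n (@ltr01 R); rewrite expr1n divr1.
- by apply: RintegrableZl => //; exact: RintegrableD.
Qed.

Variable v : R.
Hypothesis v0 : 0 <= v.
Hypothesis mgf : forall theta,
  \int[P]_w expR (theta * X w) = expR (v * theta ^+ 2 / 2).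

(** The parameter [theta] stays free: taking it to be the inverse of a standard
    deviation gives the correct scaling in the variance. *)
Lemma mgf_abs_moment_le (m : nat) (theta : R) : 0 < theta ->
  \int[P]_w `|X w| ^+ m <=
   m`!%:R / theta ^+ m * (2 * expR (v * theta ^+ 2 / 2)).
Proof.
move=> t0.
have i1 := iexp theta; have i2 := iexp (- theta).
have i12 := RintegrableD measurableT i1 i2.
have -> : m`!%:R / theta ^+ m * (2 * expR (v * theta ^+ 2 / 2)) =
  \int[P]_w (m`!%:R / theta ^+ m * (expR (theta * X w) + expR (- theta * X w))).
  by rewrite RintegralZl// RintegralD// !mgf sqrrN; ring.
apply: le_Rintegral => //.
- have := integrable_norm (mgf_integrableX m).
  by apply: eq_integrable => // w _ /=; rewrite normrX.
- exact: RintegrableZl.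
- by move=> w _; exact: normX_le_expR.
Qed.

(** The second and fourth moments are read off the Taylor coefficients at [0] of
    the symmetrised moment generating function. *)
Lemma mgf_moments24 :
  \int[P]_w (X w ^+ 2) = v /\ \int[P]_w (X w ^+ 4) = 3 * v ^+ 2.
Proof.
set a := \int[P]_w (X w ^+ 2); set b := \int[P]_w (X w ^+ 4).
(* D ^+ 2 will dominate the remainder of order 6 of the two exponentials: one
   factor for the sixth power and one for the exponential. *)
pose D w := expR (1 * X w) + expR (- 1 * X w).
pose Q w := D w ^+ 2.
have QE w : Q w = expR (2 * X w) + expR (- 2 * X w) + 2.
  rewrite /Q /D sqrrD -!expRM_natl -expRD !mulrA mulN1r mul1r subrr expR0.
  by rewrite mulrN mulr1; ring.
have icst (c : R) : P.-integrable setT (EFin \o (fun=> c)).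
  by apply: finite_measure_integrable_cst.
have i2 := RintegrableD measurableT (iexp 2) (iexp (- 2)).
have iQ : P.-integrable setT (EFin \o Q).
  have := RintegrableD measurableT i2 (icst 2).
  by apply: eq_integrable => // w _ /=; rewrite QE.
pose C := \int[P]_w Q w.
pose Z := v ^+ 3 / 8 / 6 * expR v.
suff [e1 e2] : v - a = 0 /\ v ^+ 2 / 4 - b / 12 = 0 by split; lra.
apply: (@quad_coeff_eq0 _ _ _ (2 * C + 2 * Z)) => t /andP[t0 t1].
(* The symmetrised generating function is even, hence a function of t = th ^+ 2,
   of which v and v ^+ 2 / 4 are Taylor coefficients. *)
pose th := Num.sqrt t.
have th2 : th ^+ 2 = t by rewrite sqr_sqrtr// ltW.
have th0 : 0 < th by rewrite sqrtr_gt0.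
have th1 : th <= 1 by rewrite -sqrtr1 ler_wsqrtr.
pose r w := expR (th * X w) + expR (- th * X w) - (2 + t * X w ^+ 2 + t ^+ 2 / 12 * X w ^+ 4).
have it := iexp th; have it' := iexp (- th).
have iX2 := mgf_integrableX 2; have iX4 := mgf_integrableX 4.
have ic1 := RintegrableD measurableT it it'.
have iZ2 := RintegrableZl t measurableT iX2.
have iZ4 := RintegrableZl (t ^+ 2 / 12) measurableT iX4.
have ic2 := RintegrableD measurableT (RintegrableD measurableT (icst 2) iZ2) iZ4.
have ir : P.-integrable setT (EFin \o r) by exact: (RintegrableB measurableT ic1 ic2).
have rE : \int[P]_w r w = 2 * expR (v * t / 2) - (2 + t * a + t ^+ 2 / 12 * b).
  rewrite /r RintegralB// RintegralD// !mgf sqrrN th2 RintegralD//; last first.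
    exact: (RintegrableD measurableT (icst 2) iZ2).
  rewrite RintegralD// !RintegralZl// Rintegral_cst// (_ : fine _ = 1); last by rewrite [X in fine X](@probability_setT _ _ _ P).
  rewrite -/a -/b; ring.
have rle : `|\int[P]_w r w| <= 2 * C * t ^+ 3.
  apply: (le_trans (le_normr_Rintegral _ ir)) => //.
  rewrite mulrAC -[leRHS]RintegralZl//.
  apply: le_Rintegral => //; first exact: integrable_norm.
    exact: (RintegrableZl (2 * t ^+ 3) measurableT iQ).
  move=> w _.
  have e1 := expR_taylor_le (th * X w) 6; have e2 := expR_taylor_le (- th * X w) 6.
  have -> : r w = (expR (th * X w) - \sum_(k < 6) (th * X w) ^+ k / k`!%:R) +
                  (expR (- th * X w) - \sum_(k < 6) (- th * X w) ^+ k / k`!%:R).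
    rewrite /r -th2 !big_ord_recr !big_ord0/= !factS fact0.
    by field.
  apply: (le_trans (ler_normD _ _)); apply: (le_trans (lerD e1 e2)).
  rewrite mulNr normrN -mulr2n -[leLHS]mulr_natl -[leRHS]mulrA ler_wpM2l//.
  rewrite normrM (gtr0_norm th0) exprMn (_ : th ^+ 6 = t ^+ 3); last first.
    by rewrite -th2 -exprM.
  rewrite -!(mulrA (t ^+ 3)) ler_wpM2l ?exprn_ge0 ?(ltW t0)//.
  have dX := normX_le_expR (X w) 6 (@ltr01 R).
  rewrite expr1n divr1 -ler_pdivrMl ?ltr0n ?fact_gt0// mulrC in dX.
  rewrite /Q [D w ^+ 2]expr2; apply: ler_pM => //.
  apply: (@le_trans _ _ (expR `|X w|)).
    by rewrite ler_expR ler_piMl.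
  rewrite /D mul1r mulN1r; have [x0|x0] := ger0P (X w).
    by rewrite lerDl expR_ge0.
  by rewrite lerDr expR_ge0.
have ele : `|expR (v * t / 2) - (1 + v * t / 2 + (v * t / 2) ^+ 2 / 2)| <= Z * t ^+ 3.
  have y0 : 0 <= v * t / 2 by rewrite divr_ge0// mulr_ge0// ltW.
  have := expR_taylor_le (v * t / 2) 3.
  rewrite !big_ord_recr !big_ord0/= (_ : 0 + _ + _ + _ =
    1 + v * t / 2 + (v * t / 2) ^+ 2 / 2); last by rewrite !factS fact0; field.
  move=> /le_trans; apply; rewrite (ger0_norm y0).
  have -> : (v * t / 2) ^+ 3 / 3`!%:R * expR (v * t / 2) =
     (v ^+ 3 / 8 / 6 * t ^+ 3) * expR (v * t / 2).
    by rewrite !factS fact0; field.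
  rewrite /Z [leRHS]mulrAC; apply: ler_wpM2l.
    by rewrite !mulr_ge0// ?exprn_ge0// ?invr_ge0// ltW.
  rewrite ler_expR; nra.
have -> : (v - a) * t + (v ^+ 2 / 4 - b / 12) * t ^+ 2 =
  \int[P]_w r w - 2 * (expR (v * t / 2) - (1 + v * t / 2 + (v * t / 2) ^+ 2 / 2)).
  by rewrite rE; field.
apply: (le_trans (ler_normB _ _)); rewrite [leRHS]mulrDl lerD//.
by rewrite normrM ger0_norm// -[leRHS]mulrA ler_wpM2l.
Qed.

End mgf_moments.

(** * Gaussian spaces and Isserlis' formula *)

Section gaussian_space.
Context {dO : measure_display} {Omega : measurableType dO} {R : realType}.
Variable P : probability Omega R.

Lemma centered_gaussian_mgf (X : Omega -> R) :
  gaussian_rv P X -> ('E_P[X] = 0)%E ->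
  [/\ measurable_fun setT X,
      (forall theta, P.-integrable setT (EFin \o (fun w => expR (theta * X w)))) &
      exists2 v, 0 <= v & forall theta,
        \int[P]_w expR (theta * X w) = expR (v * theta ^+ 2 / 2)].
Proof.
move=> gX EX0; have [mX _] := gX.
have [m [v [v0 mgf]]] := gaussian_rv_mgf gX.
have iexp theta : P.-integrable setT (EFin \o (fun w => expR (theta * X w))).
  apply/integrableP; split.
    by apply/measurable_EFinP/measurableT_comp => //; exact: measurable_funM.
  under eq_integral do rewrite /= ger0_norm ?expR_ge0//.
  by rewrite mgf ltry.
have rmgf theta : \int[P]_w expR (theta * X w) =
    expR (m * theta + v * theta ^+ 2 / 2) by rewrite /Rintegral mgf.
have iX : P.-integrable setT (EFin \o X).
  by have := mgf_integrableX mX iexp 1; under eq_fun do rewrite expr1.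
have rX : \int[P]_w X w = 0 by rewrite /Rintegral; move: EX0; rewrite unlock => ->.
(* Jensen's inequality for exp forces the tilted means to be nonnegative for
   every theta, which is only possible when m = 0. *)
have pos theta : 0 <= m * theta + v * theta ^+ 2 / 2.
  rewrite -ler_expR expR0 -rmgf.
  have i1 : P.-integrable setT (EFin \o (fun=> 1 : R)).
    exact: finite_measure_integrable_cst.
  have iZ := RintegrableZl theta measurableT iX.
  have -> : 1 = \int[P]_w (1 + theta * X w).
    rewrite RintegralD// RintegralZl// rX mulr0 addr0 Rintegral_cst//.
    by rewrite mul1r [X in fine X](@probability_setT _ _ _ P).
  apply: le_Rintegral => //; first exact: RintegrableD.
  by move=> w _; exact: expR_ge1Dx.
have m0 : m = 0.
  apply/eqP; apply: contraT => mn0.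
  have := pos (- m / (v + 1)).
  have v1 : 0 < v + 1 by lra.
  have -> : m * (- m / (v + 1)) + v * (- m / (v + 1)) ^+ 2 / 2 =
    - (m ^+ 2 * (v + 2) / (2 * (v + 1) ^+ 2)) by field; rewrite gt_eqF.
  rewrite oppr_ge0 leNgt => /negP; case.
  have m2 : 0 < m ^+ 2 by rewrite exprn_even_gt0.
  by rewrite divr_gt0 ?(mulr_gt0 m2) ?mulr_gt0 ?(exprn_gt0 2 v1)//; lra.
split => //; exists v => // theta; by rewrite rmgf m0 mul0r add0r.
Qed.

Variables (I : Type) (X : I -> Omega -> R).
Hypothesis GX : centered_gaussian_process P X.

(** Every element of this linear span is again a centered Gaussian variable; the
    increments of all the coordinates of a multivariate process lie in it. *)
Definition gaussian_space : set (Omega -> R) :=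
  [set Z | exists (n : nat) (t : 'I_n -> I) (c : 'I_n -> R),
     Z = fun w => \sum_(k < n) c k * X (t k) w].

Lemma gaussian_space_mem i : gaussian_space (X i).
Proof.
exists 1%N, (fun=> i), (fun=> 1); apply/funext => w.
by rewrite big_ord1 mul1r.
Qed.

Lemma gaussian_spaceD Y Z : gaussian_space Y -> gaussian_space Z ->
  gaussian_space (fun w => Y w + Z w).
Proof.
move=> [n [t [c ->]]] [m [s [e ->]]].
pose g T (f : 'I_n -> T) (h : 'I_m -> T) (k : 'I_(n + m)) : T :=
  match fintype.split k with inl j => f j | inr j => h j end.
exists (n + m)%N, (g _ t s), (g _ c e); apply/funext => w.
rewrite big_split_ord/=; congr (_ + _); apply: eq_bigr => k _; rewrite /g.
  by rewrite (unsplitK (inl k : 'I_n + 'I_m)%type).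
by rewrite (unsplitK (inr k : 'I_n + 'I_m)%type).
Qed.

Lemma gaussian_spaceZ a Z : gaussian_space Z -> gaussian_space (fun w => a * Z w).
Proof.
move=> [n [t [c ->]]]; exists n, t, (fun k => a * c k); apply/funext => w.
by rewrite mulr_sumr; apply: eq_bigr => k _; rewrite mulrA.
Qed.

Lemma gaussian_spaceB Y Z : gaussian_space Y -> gaussian_space Z ->
  gaussian_space (fun w => Y w - Z w).
Proof.
move=> GY GZ; have := gaussian_spaceD GY (gaussian_spaceZ (-1) GZ).
by under eq_fun do rewrite mulN1r.
Qed.

Lemma gaussian_process_mean0 i :
  P.-integrable setT (EFin \o X i) /\ \int[P]_w X i w = 0.
Proof.
have gi : gaussian_rv P (X i).
  have := GX.1 1%N (fun=> i) (fun=> 1).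
  by under eq_fun do rewrite big_ord1 mul1r.
have [mX iexp _] := centered_gaussian_mgf gi (GX.2 i); split.
  by have := mgf_integrableX mX iexp 1; under eq_fun do rewrite expr1.
by have := GX.2 i; rewrite unlock /Rintegral => ->.
Qed.

Lemma gaussian_space_mgf Z : gaussian_space Z ->
  [/\ measurable_fun setT Z,
      (forall theta, P.-integrable setT (EFin \o (fun w => expR (theta * Z w)))) &
      exists2 v, 0 <= v & forall theta,
        \int[P]_w expR (theta * Z w) = expR (v * theta ^+ 2 / 2)].
Proof.
move=> [n [t [c ->]]]; apply: centered_gaussian_mgf; first exact: GX.1.
suff [iS S0] : P.-integrable setT (EFin \o (fun w => \sum_(k < n) c k * X (t k) w))
    /\ \int[P]_w (\sum_(k < n) c k * X (t k) w) = 0.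
  by rewrite unlock -[LHS]fineK ?integrable_fin_num//; rewrite [fine _]S0.
elim: n t c => [|n IH] t c.
  have -> : (fun w => \sum_(k < 0) c k * X (t k) w) = fun=> 0.
    by apply/funext => w; rewrite big_ord0.
  split; first exact: finite_measure_integrable_cst.
  by rewrite Rintegral_cst// mul0r.
have [iS S0] := IH (fun k => t (widen_ord (leqnSn n) k))
  (fun k => c (widen_ord (leqnSn n) k)).
have [iX X0] := gaussian_process_mean0 (t ord_max).
have iZ := RintegrableZl (c ord_max) measurableT iX.
have -> : (fun w => \sum_(k < n.+1) c k * X (t k) w) = fun w =>
    \sum_(k < n) c (widen_ord (leqnSn n) k) * X (t (widen_ord (leqnSn n) k)) w +
    c ord_max * X (t ord_max) w.
  by apply/funext => w; rewrite big_ord_recr.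
split; first exact: RintegrableD.
by rewrite RintegralD// S0 RintegralZl// X0 mulr0 addr0.
Qed.

Lemma gaussian_space_measurable Z : gaussian_space Z -> measurable_fun setT Z.
Proof. by move=> /gaussian_space_mgf[]. Qed.

Lemma gaussian_space_integrableX Z n : gaussian_space Z ->
  P.-integrable setT (EFin \o (fun w => Z w ^+ n)).
Proof. by move=> /gaussian_space_mgf[mZ iexp _]; exact: mgf_integrableX. Qed.

Lemma gaussian_space_moment4 Z : gaussian_space Z ->
  \int[P]_w (Z w ^+ 4) = 3 * (\int[P]_w (Z w ^+ 2)) ^+ 2.
Proof.
move=> /gaussian_space_mgf[mZ iexp [v v0 mgf]].
by have [-> ->] := mgf_moments24 mZ iexp v0 mgf.
Qed.

Lemma gaussian_space_moment_le Z m theta : gaussian_space Z -> 0 < theta ->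
  \int[P]_w `|Z w| ^+ m <= m`!%:R / theta ^+ m *
    (2 * expR ((\int[P]_w (Z w ^+ 2)) * theta ^+ 2 / 2)).
Proof.
move=> /gaussian_space_mgf[mZ iexp [v v0 mgf]] t0.
have [-> _] := mgf_moments24 mZ iexp v0 mgf.
exact: mgf_abs_moment_le.
Qed.

End gaussian_space.

Lemma Rintegral_comb4 d (T : measurableType d) (R : realType)
    (mu : {measure set T -> \bar R}) (f1 f2 f3 f4 : T -> R) (a1 a2 a3 a4 : R) :
  mu.-integrable setT (EFin \o f1) -> mu.-integrable setT (EFin \o f2) ->
  mu.-integrable setT (EFin \o f3) -> mu.-integrable setT (EFin \o f4) ->
  let f x := a1 * f1 x + a2 * f2 x + a3 * f3 x + a4 * f4 x in
  mu.-integrable setT (EFin \o f) /\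
  \int[mu]_x f x = a1 * \int[mu]_x f1 x + a2 * \int[mu]_x f2 x
                 + a3 * \int[mu]_x f3 x + a4 * \int[mu]_x f4 x.
Proof.
move=> i1 i2 i3 i4 f.
have j1 := RintegrableZl a1 measurableT i1; have j2 := RintegrableZl a2 measurableT i2.
have j3 := RintegrableZl a3 measurableT i3; have j4 := RintegrableZl a4 measurableT i4.
have j12 := RintegrableD measurableT j1 j2.
have j123 := RintegrableD measurableT j12 j3.
split; first exact: (RintegrableD measurableT j123 j4).
by rewrite /f !RintegralD// !RintegralZl.
Qed.

Section wick.
Context {dO : measure_display} {Omega : measurableType dO} {R : realType}.
Variable P : probability Omega R.
Variables (I : Type) (X : I -> Omega -> R).
Hypothesis GX : centered_gaussian_process P X.
Let G := gaussian_space X.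
Let C (Y Z : Omega -> R) := \int[P]_w (Y w * Z w).

Lemma gaussian_integrableM Y Z : G Y -> G Z ->
  P.-integrable setT (EFin \o (fun w => Y w * Z w)).
Proof.
move=> GY GZ.
have iD := gaussian_space_integrableX GX 2 (gaussian_spaceD GY GZ).
have iB := gaussian_space_integrableX GX 2 (gaussian_spaceB GY GZ).
have [i _] := Rintegral_comb4 (4^-1) (- 4^-1) 0 0 iD iB iD iB.
move: i; apply: eq_integrable => // w _ /=; congr EFin; by field.
Qed.

Lemma gaussian_cov_linl a Y Y' Z : G Y -> G Y' -> G Z ->
  C (fun w => Y w + a * Y' w) Z = C Y Z + a * C Y' Z.
Proof.
move=> GY GY' GZ; have i := gaussian_integrableM GY GZ.
have i' := gaussian_integrableM GY' GZ.
rewrite /C; under eq_Rintegral do rewrite mulrDl -mulrA.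
by rewrite RintegralD ?RintegralZl//; exact: RintegrableZl.
Qed.

Lemma gaussian_covC Y Z : C Y Z = C Z Y.
Proof. by rewrite /C; under eq_Rintegral do rewrite mulrC. Qed.

Lemma gaussian_cov_linr a Y Y' Z : G Y -> G Y' -> G Z ->
  C Z (fun w => Y w + a * Y' w) = C Z Y + a * C Z Y'.
Proof. by move=> GY GY' GZ; rewrite !(gaussian_covC Z) gaussian_cov_linl. Qed.

Lemma gaussian_space_lin a Y Z : G Y -> G Z -> G (fun w => Y w + a * Z w).
Proof. by move=> GY GZ; apply: gaussian_spaceD => //; exact: gaussian_spaceZ. Qed.

Lemma gaussian_moment4_lin a Y Z : G Y -> G Z ->
  \int[P]_w ((Y w + a * Z w) ^+ 4) =
  3 * (C Y Y + 2 * a * C Y Z + a ^+ 2 * C Z Z) ^+ 2.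
Proof.
move=> GY GZ; have GL := gaussian_space_lin a GY GZ.
rewrite (gaussian_space_moment4 GX GL) -[X in 3 * X ^+ 2]/(C _ _).
rewrite gaussian_cov_linl// !gaussian_cov_linr// (gaussian_covC Z Y).
by congr (3 * _ ^+ 2); ring.
Qed.

(** Polarisation: [y ^+ 2 * z ^+ 2] is a combination of the fourth powers of [y + z],
    [y - z], [y] and [z], whose means are given by their variances. *)
Lemma wick_sqr Y Z : G Y -> G Z ->
  P.-integrable setT (EFin \o (fun w => Y w ^+ 2 * Z w ^+ 2)) /\
  \int[P]_w (Y w ^+ 2 * Z w ^+ 2) = C Y Y * C Z Z + 2 * C Y Z ^+ 2.
Proof.
move=> GY GZ.
have GD := gaussian_space_lin 1 GY GZ; have GB := gaussian_space_lin (-1) GY GZ.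
have iY := gaussian_space_integrableX GX 4 GY.
have iZ := gaussian_space_integrableX GX 4 GZ.
have iD := gaussian_space_integrableX GX 4 GD.
have iB := gaussian_space_integrableX GX 4 GB.
have [i e] := Rintegral_comb4 (12^-1) (12^-1) (- 6^-1) (- 6^-1) iD iB iY iZ.
have E : (fun w => Y w ^+ 2 * Z w ^+ 2) = fun w => 12^-1 * (Y w + 1 * Z w) ^+ 4
    + 12^-1 * (Y w + -1 * Z w) ^+ 4 + - 6^-1 * Y w ^+ 4 + - 6^-1 * Z w ^+ 4.
  by apply/funext => w; field.
rewrite E; split => //; rewrite e !gaussian_moment4_lin//.
rewrite (gaussian_space_moment4 GX GY) (gaussian_space_moment4 GX GZ).
rewrite -[\int[P]_w (Y w ^+ 2)]/(C Y Y) -[\int[P]_w (Z w ^+ 2)]/(C Z Z).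
by field.
Qed.

(** Isserlis' formula: fourth moments of linear combinations determine the mixed
    fourth moments, by polarising first the pair of squares and then each of the
    two products. *)
Lemma wick Z1 Z2 Z3 Z4 : G Z1 -> G Z2 -> G Z3 -> G Z4 ->
  P.-integrable setT (EFin \o (fun w => Z1 w * Z2 w * (Z3 w * Z4 w))) /\
  \int[P]_w (Z1 w * Z2 w * (Z3 w * Z4 w)) =
    C Z1 Z2 * C Z3 Z4 + C Z1 Z3 * C Z2 Z4 + C Z1 Z4 * C Z2 Z3.
Proof.
move=> G1 G2 G3 G4.
have GD := gaussian_space_lin 1 G1 G2; have GB := gaussian_space_lin (-1) G1 G2.
have GD' := gaussian_space_lin 1 G3 G4; have GB' := gaussian_space_lin (-1) G3 G4.
have [i1 e1] := wick_sqr GD GD'; have [i2 e2] := wick_sqr GD GB'.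
have [i3 e3] := wick_sqr GB GD'; have [i4 e4] := wick_sqr GB GB'.
have [i e] := Rintegral_comb4 (16^-1) (- 16^-1) (- 16^-1) (16^-1) i1 i2 i3 i4.
have E : (fun w => Z1 w * Z2 w * (Z3 w * Z4 w)) =
    fun w => 16^-1 * ((Z1 w + 1 * Z2 w) ^+ 2 * (Z3 w + 1 * Z4 w) ^+ 2)
    + - 16^-1 * ((Z1 w + 1 * Z2 w) ^+ 2 * (Z3 w + -1 * Z4 w) ^+ 2)
    + - 16^-1 * ((Z1 w + -1 * Z2 w) ^+ 2 * (Z3 w + 1 * Z4 w) ^+ 2)
    + 16^-1 * ((Z1 w + -1 * Z2 w) ^+ 2 * (Z3 w + -1 * Z4 w) ^+ 2).
  by apply/funext => w; field.
rewrite E; split => //; rewrite e e1 e2 e3 e4.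
rewrite !gaussian_cov_linl// !gaussian_cov_linr//.
rewrite (gaussian_covC Z2 Z1) (gaussian_covC Z4 Z3).
by field.
Qed.

End wick.

(** * Second differences at infinity *)

Section second_difference.
Variable R : realType.
Implicit Types (f g : R -> R) (a b x : R).

Lemma is_derive_comp_add f a x d :
  is_derive (x + a) 1 f d -> is_derive x 1 (fun y => f (y + a)) d.
Proof.
move=> df; rewrite -[d]mulr1.
exact: (@is_derive1_comp _ f (shift a) x d 1 df (is_derive_shift _ _ _)).
Qed.

(** Mixed second difference with steps [a] and [b], the form taken by covariances of
    increments. *)
Definition secdiff f a b x : R := f (x + a + b) - f (x + a) - f (x + b) + f x.

Lemma lipschitz_of_derive f (f1 : R -> R) (M K x y : R) :
  (forall z, M < z -> is_derive z 1 f (f1 z)) ->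
  (forall z, M < z -> `|f1 z| <= K) -> M < x -> M < y ->
  `|f y - f x| <= K * `|y - x|.
Proof.
move=> df f1K; wlog xy : x y / x <= y => [H|] Mx My.
  by have [/H|/ltW/H] := leP x y; [exact|rewrite distrC [`|y - x|]distrC; exact].
have dfz z : z \in `[x, y] -> is_derive z 1 f (f1 z).
  by rewrite in_itv/= => /andP[xz _]; apply: df; exact: lt_le_trans xz.
have [c] := MVT_segment xy (fun z zi => dfz z (subset_itv_oo_cc zi)) (derivable_within_continuous (fun z zi => @ex_derive _ _ _ _ _ _ _ (dfz z zi))).
rewrite in_itv/= => /andP[xc _] ->.
by rewrite normrM ler_wpM2r// f1K//; exact: lt_le_trans xc.
Qed.

(** Two applications of the mean value theorem turn a second derivative that
    vanishes at infinity into a second difference that vanishes at infinity. *)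
Lemma secdiff_vanish f (f1 f2 : R -> R) :
  (forall x, 0 < x -> is_derive x 1 f (f1 x)) ->
  (forall x, 0 < x -> is_derive x 1 f1 (f2 x)) ->
  (forall e, 0 < e -> exists M, forall x, M < x -> `|f2 x| <= e) ->
  forall a b e, 0 < e -> exists M, forall x, M < x -> `|secdiff f a b x| <= e.
Proof.
move=> df df1 f2v a b e e0.
pose K := e / (`|a| * `|b| + 1).
have ab1 : 0 < `|a| * `|b| + 1 by rewrite ltr_wpDl// mulr_ge0.
have K0 : 0 < K by rewrite divr_gt0.
have [M0 HM0] := f2v _ K0.
pose M := Num.max M0 0 + `|b|.
exists (M + `|a|) => x Mx.
have [na nb] : - `|a| <= a /\ - `|b| <= b by rewrite !lerNnormlW.
have MM0 : M0 <= Num.max M0 0 by rewrite le_max lexx.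
have M00 : 0 <= Num.max M0 0 by rewrite le_max lexx orbT.
have a0 := normr_ge0 a; have b0 := normr_ge0 b.
pose F y := f (y + b) - f y.
have dF y : M < y -> is_derive y 1 F (f1 (y + b) - f1 y).
  move=> My; apply: is_deriveB; last by apply: df; rewrite /M in My; lra.
  by apply: is_derive_comp_add; apply: df; rewrite /M in My; lra.
have F1 y : M < y -> `|f1 (y + b) - f1 y| <= K * `|b|.
  move=> My; rewrite -{2}(addrK y b) [b + y]addrC.
  apply: (@lipschitz_of_derive f1 f2 (Num.max M0 0)).
  - by move=> z Mz; apply: df1; exact: le_lt_trans Mz.
  - by move=> z Mz; apply: HM0; exact: le_lt_trans Mz.
  - by rewrite /M in My; lra.
  - by rewrite /M in My; lra.
have -> : secdiff f a b x = F (x + a) - F x by rewrite /secdiff /F; ring.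
apply: (le_trans (lipschitz_of_derive dF F1 _ _)); try lra.
have -> : x + a - x = a by ring.
have KD : K * (`|a| * `|b| + 1) = e by rewrite /K divfK// gt_eqF.
by rewrite -KD; lra.
Qed.

Lemma powR_vanish (c : R) : 0 < c -> forall e, 0 < e ->
  exists M, forall x, M < x -> `|x `^ (- c)| <= e.
Proof.
move=> c0 e e0; exists ((e^-1) `^ c^-1) => x Mx.
have M0 : 0 < (e^-1) `^ c^-1 by rewrite powR_gt0// invr_gt0.
have x0 : 0 < x by exact: lt_trans Mx.
rewrite ger0_norm ?powR_ge0// powRN invf_ple ?posrE ?powR_gt0//.
have -> : e^-1 = ((e^-1) `^ c^-1) `^ c.
  by rewrite -powRrM mulVf ?gt_eqF// powRr1// ltW// invr_gt0.
by rewrite ge0_ler_powR ?nnegrE ?ltW.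
Qed.

(** The second derivative is of order [x `^ (h - 2)]. *)
Lemma secdiff_powR (h a b e : R) : h < 2 -> 0 < e ->
  exists M, forall x, M < x -> `|secdiff (fun x => x `^ h) a b x| <= e.
Proof.
move=> h2; apply: (@secdiff_vanish _ (fun x => h * x `^ (h - 1))
  (fun x => h * ((h - 1) * x `^ (h - 1 - 1)))).
- move=> x x0; have := @is_derive1_powR R (h - 1) x x0.
  by move/(@is_deriveZ _ _ _ _ h).
- move=> d d0; have c0 : 0 < 2 - h by lra.
  pose D := `|h * (h - 1)| + 1.
  have D0 : 0 < D by rewrite ltr_wpDl.
  have [M HM] := powR_vanish c0 (divr_gt0 d0 D0).
  exists M => x /HM; have -> : - (2 - h) = h - 1 - 1 by ring.
  rewrite ler_pdivlMr// mulrA normrM => h1; apply: le_trans h1.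
  by rewrite mulrC ler_wpM2l// lerDl.
Qed.

(** The second derivative is [x^-1]. *)
Lemma secdiff_xlnx (a b e : R) : 0 < e ->
  exists M, forall x, M < x -> `|secdiff (fun x => x * ln x) a b x| <= e.
Proof.
apply: (@secdiff_vanish _ (fun x => ln x + 1) (fun x => x^-1)).
- move=> x x0; have D := is_deriveM (is_derive_id x 1) (is_derive1_ln x0).
  apply: (is_derive_eq D); rewrite -![_ *: _]/(_ * _) mulr1 mulfV ?gt_eqF//.
  by rewrite addrC.
- move=> x x0; have := is_deriveD (is_derive1_ln x0) (is_derive_cst (1 : R) x 1).
  by rewrite addr0.
- move=> d d0; exists (d^-1) => x dx.
  have d1 : 0 < d^-1 by rewrite invr_gt0.
  have x0 := lt_trans d1 dx.
  by rewrite ger0_norm ?invr_ge0 ?ltW// invf_plt ?posrE// ltW.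
Qed.

(** Far from [0] the four points of a second difference lie on the same side, where
    [f] is [p] or the mirror image of [q]. *)
Lemma secdiff_twosided f (p q : R -> R) :
  (forall x, 0 < x -> f x = p x) -> (forall x, 0 < x -> f (- x) = q x) ->
  (forall a b e, 0 < e -> exists M, forall x, M < x -> `|secdiff p a b x| <= e) ->
  (forall a b e, 0 < e -> exists M, forall x, M < x -> `|secdiff q a b x| <= e) ->
  forall a b e, 0 < e -> exists M, forall x, M < `|x| -> `|secdiff f a b x| <= e.
Proof.
move=> fp fq pv qv a b e e0.
have [M HM] := pv a b e e0; have [N HN] := qv (- a) (- b) e e0.
have [aa ab] : - `|a| <= a /\ a <= `|a| by rewrite lerNnormlW// ler_norm.
have [ba bb] : - `|b| <= b /\ b <= `|b| by rewrite lerNnormlW// ler_norm.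
have [Mn Nn] : M <= `|M| /\ N <= `|N| by rewrite !ler_norm.
have [M0 N0] : 0 <= `|M| /\ 0 <= `|N| by [].
exists (`|M| + `|N| + `|a| + `|b|) => x.
have [x0|x0] := ger0P x => Mx.
  have -> : secdiff f a b x = secdiff p a b x by rewrite /secdiff !fp//; lra.
  by apply: HM; lra.
have fq' y : y < 0 -> f y = q (- y) by move=> y0; rewrite -fq ?opprK ?oppr_gt0.
have -> : secdiff f a b x = secdiff q (- a) (- b) (- x).
  by rewrite /secdiff !fq' ?opprD//; lra.
by apply: HN; lra.
Qed.

End second_difference.

(** * Polynomial growth of Gaussian paths *)

Section chaining.
Variables (R : realType) (b : R -> R) (M theta : R).
Hypotheses (cb : continuous b) (M0 : 0 <= M) (t0 : 0 <= theta) (t1 : theta < 1).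
Hypothesis incr_le : forall n k : nat,
  `|b (k.+1%:R / 2 ^+ n) - b (k%:R / 2 ^+ n)| <=
  M * theta ^+ n * (1 + k%:R / 2 ^+ n) ^+ 2.

Lemma sum_geom_le (z : R) N : 0 <= z -> z < 1 -> \sum_(m < N) z ^+ m <= (1 - z)^-1.
Proof.
move=> z0 z1; rewrite -[leRHS]mulr1 ler_pdivlMl ?subr_gt0//.
by rewrite -opprB mulNr -subrX1 opprB gerBl exprn_ge0.
Qed.

(** A dyadic point of level [n + 1] is a point of level [n] or one increment of level
    [n + 1] away from such a point; the points of level [0] are reached by unit
    increments, which produce the linear factor. *)
Lemma dyadic_growth n k :
  `|b (k%:R / 2 ^+ n) - b 0| <= M * (1 + k%:R / 2 ^+ n) ^+ 2 *
     (k%:R / 2 ^+ n + \sum_(m < n.+1) theta ^+ m).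
Proof.
have p2 m : 0 < 2 ^+ m :> R by rewrite exprn_gt0.
elim: n k => [|n IH] k.
  rewrite expr0 divr1 big_ord1 expr0.
  elim: k => [|k IHk].
    by rewrite subrr normr0 !mulr_ge0// ?addr_ge0.
  have -> : b k.+1%:R - b 0 = (b k.+1%:R - b k%:R) + (b k%:R - b 0) by ring.
  apply: (le_trans (ler_normD _ _)).
  have := incr_le 0 k; rewrite expr0 !divr1 mulr1 => h.
  have k0 : 0 <= k%:R :> R by [].
  have W : (1 + k%:R) ^+ 2 <= (1 + k.+1%:R) ^+ 2 :> R.
    by rewrite ler_pXn2r ?nnegrE ?addr_ge0// lerD2l ler_nat.
  have MW := ler_wpM2l M0 W.
  rewrite -natr1 in h W MW *.
  apply: (le_trans (lerD h IHk)).
  have -> : M * (1 + k%:R) ^+ 2 + M * (1 + k%:R) ^+ 2 * (k%:R + 1) =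
    M * (1 + k%:R) ^+ 2 * (k%:R + 1 + 1) by ring.
  by rewrite ler_wpM2r// !addr_ge0.
have step j : `|b (j.*2%:R / 2 ^+ n.+1) - b 0| <=
    M * (1 + j.*2%:R / 2 ^+ n.+1) ^+ 2 *
     (j.*2%:R / 2 ^+ n.+1 + \sum_(m < n.+1) theta ^+ m).
  have -> : j.*2%:R / 2 ^+ n.+1 = j%:R / 2 ^+ n :> R.
    by rewrite -muln2 natrM exprS; field; rewrite gt_eqF.
  exact: IH.
have S0 : 0 <= \sum_(m < n.+1) theta ^+ m by apply: sumr_ge0 => m _; exact: exprn_ge0.
have e0 : 0 <= theta ^+ n.+1 by exact: exprn_ge0.
have mono (x y : R) : 0 <= x -> x <= y -> M * (1 + x) ^+ 2 <= M * (1 + y) ^+ 2.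
  move=> x0 xy; rewrite ler_wpM2l// ler_pXn2r ?nnegrE ?addr_ge0 ?lerD2l//.
  exact: le_trans xy.
rewrite big_ord_recr/= -(odd_double_half k); case: (odd k); last first.
  rewrite add0n; apply: (le_trans (step _)).
  rewrite ler_wpM2l//; last by rewrite addrA lerDl.
  by rewrite mulr_ge0// exprn_ge0// addr_ge0// divr_ge0// ltW.
rewrite add1n; set j := k./2.
have -> : b (j.*2.+1%:R / 2 ^+ n.+1) - b 0 =
  (b (j.*2.+1%:R / 2 ^+ n.+1) - b (j.*2%:R / 2 ^+ n.+1)) +
  (b (j.*2%:R / 2 ^+ n.+1) - b 0) by ring.
apply: (le_trans (ler_normD _ _)).
have := incr_le n.+1 j.*2 => h; apply: (le_trans (lerD h (step _))).
set x := j.*2%:R / 2 ^+ n.+1; set y := j.*2.+1%:R / 2 ^+ n.+1.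
have x0 : 0 <= x by rewrite divr_ge0// ltW.
have xy : x <= y by rewrite ler_wpM2r ?invr_ge0 ?ltW// ltr_nat.
rewrite mulrAC -mulrDr.
have W0 : 0 <= M * (1 + x) ^+ 2 by rewrite mulr_ge0// exprn_ge0// addr_ge0.
apply: ler_pM => //; first by rewrite !addr_ge0.
  exact: mono.
by lra.
Qed.

Lemma chaining_growth (x : R) : 0 <= x ->
  `|b x - b 0| <= M * (1 + (1 - theta)^-1) * (1 + x) ^+ 3.
Proof.
move=> x0; have p2 m : 0 < 2 ^+ m :> R by rewrite exprn_gt0.
have g0 : 0 <= (1 - theta)^-1 by rewrite invr_ge0 subr_ge0 ltW.
pose u n : R := (Num.truncn (x * 2 ^+ n))%:R / 2 ^+ n.
have ux n : 0 <= u n <= x.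
  rewrite divr_ge0 ?(ltW (p2 _))//= ler_pdivrMr//.
  by rewrite truncn_le// mulr_ge0// ltW.
have cu : u @ \oo --> x.
  have d0 : (fun n => (2^-1) ^+ n : R) @ \oo --> (0:R).
    by apply: cvg_expr; rewrite ger0_norm ?invf_lt1 ?ltr1n.
  apply/cvgrPdist_le => /= e e0.
  move/cvgrPdist_le : d0 => /(_ _ e0); apply: filterS => n.
  rewrite sub0r normrN ger0_norm ?exprn_ge0// => h; apply: le_trans h.
  have /andP[_ un] := ux n; rewrite ger0_norm ?subr_ge0//.
  rewrite /u exprVn lerBlDl -(ler_pM2r (p2 n)).
  rewrite mulrDl mulVf ?gt_eqF// divfK ?gt_eqF//.
  by rewrite natr1 ltW// truncnS_gt.
have cbu : (fun n => `|b (u n) - b 0|) @ \oo --> `|b x - b 0|.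
  apply: cvg_norm; apply: cvgB; last exact: cvg_cst.
  by apply: cvg_comp cu _; exact: cb.
rewrite -(cvg_lim _ cbu)//; apply: limr_le; first by apply/cvg_ex; eexists; exact: cbu.
apply: nearW => n; have /andP[u0 un] := ux n.
apply: (le_trans (dyadic_growth _ _)); rewrite -/(u n).
have -> : M * (1 + (1 - theta)^-1) * (1 + x) ^+ 3 =
  (M * (1 + x) ^+ 2) * ((1 + (1 - theta)^-1) * (1 + x)) by ring.
have S := sum_geom_le n.+1 t0 t1.
apply: ler_pM.
- by rewrite mulr_ge0// exprn_ge0// addr_ge0.
- by rewrite addr_ge0//; apply: sumr_ge0 => m _; exact: exprn_ge0.
- by rewrite ler_wpM2l// ler_pXn2r ?nnegrE ?addr_ge0// lerD2l.
- rewrite mulrDl mul1r.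
  have h : 0 <= (1 - theta)^-1 * x by rewrite mulr_ge0.
  by rewrite mulrDr mulr1; lra.
Qed.

End chaining.

Lemma nneseries_le_bounded (R : realType) (a : nat -> R) (K : R) :
  (forall n, 0 <= a n) -> (forall N, \sum_(0 <= k < N) a k <= K) ->
  (\sum_(0 <= k <oo) (a k)%:E <= K%:E)%E.
Proof.
move=> a0 aK; apply: lime_le.
  by apply: is_cvg_nneseries => n _ _; rewrite lee_fin.
by apply: nearW => N; rewrite sumEFin lee_fin.
Qed.

Lemma nneseries_ge_term (R : realType) (a : nat -> \bar R) (n : nat) :
  (forall n, 0 <= a n)%E -> (a n <= \sum_(0 <= k <oo) a k)%E.
Proof.
move=> a0; apply: (le_trans _ (@nneseries_lim_ge _ _ xpredT 0 n.+1 _)) => //.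
by rewrite big_nat_recr//= leeDr// sume_ge0.
Qed.

Section path_growth.
Context {dO : measure_display} {Omega : measurableType dO} {R : realType}.
Variable P : probability Omega R.
Variables (J : Type) (X : J -> Omega -> R).
Hypothesis GX : centered_gaussian_process P X.
Variables (b : R -> Omega -> R) (H : R).
Hypotheses (H0 : 0 < H) (Gb : forall t, gaussian_space X (b t)).
Hypothesis cb : forall w, continuous (b ^~ w).
Hypothesis varb : forall x y,
  \int[P]_w ((b x w - b y w) ^+ 2) = `|x - y| `^ (2 * H).

(* [theta ^+ (4 * n)] is the standard deviation [2 `^ (- n * H)] of an increment of
   level [n]. The paths are shown to have increments of order [theta ^+ n], which
   leaves room for the union over the points of each level. *)
Let theta : R := 2 `^ (- H / 4).

Let theta_gt0 : 0 < theta. Proof. by rewrite powR_gt0. Qed.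

Let theta_lt1 : theta < 1.
Proof.
rewrite /theta mulNr powRN invf_lt1 ?powR_gt0//.
rewrite -[ltLHS](powRr0 2) /powR pnatr_eq0/= ltr_expR ltr_pM2r ?ln_gt0 ?ltr1n//.
by rewrite divr_gt0.
Qed.

Let incr_moment (p n k : nat) :
  \int[P]_w (`|b (k.+1%:R / 2 ^+ n) w - b (k%:R / 2 ^+ n) w| ^+ p) <=
  p`!%:R * (2 * expR 2^-1) * theta ^+ (4 * n * p).
Proof.
have p2 m : 0 < 2 ^+ m :> R by rewrite exprn_gt0.
set d := fun w => _.
have Gd : gaussian_space X (fun w => b (k.+1%:R / 2 ^+ n) w - b (k%:R / 2 ^+ n) w).
  exact: gaussian_spaceB.
have th0 : 0 < theta ^+ (4 * n) by rewrite exprn_gt0.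
pose l := (theta ^+ (4 * n))^-1.
have l0 : 0 < l by rewrite invr_gt0.
apply: (le_trans (gaussian_space_moment_le GX p Gd l0)).
have -> : k.+1%:R / 2 ^+ n = k%:R / 2 ^+ n + (2 ^+ n)^-1 :> R.
  by rewrite -natr1 mulrDl mul1r.
rewrite varb.
have -> : k%:R / 2 ^+ n + (2 ^+ n)^-1 - k%:R / 2 ^+ n = (2 ^+ n)^-1 :> R by ring.
rewrite ger0_norm; last by rewrite invr_ge0 ltW.
have e : (2 ^+ n)^-1 `^ (2 * H) = (theta ^+ (4 * n)) ^+ 2 :> R.
  rewrite /theta -powR_invn//.
  have -> : 2 `^ (- H / 4) ^+ (4 * n) = 2 `^ (- H / 4 * (4 * n)%:R) :> R.
    by rewrite [RHS]powRrM powR_mulrn ?powR_ge0.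
  have sq (z : R) : (2 `^ z) ^+ 2 = 2 `^ (z * 2) :> R.
    by rewrite [RHS]powRrM powR_mulrn// powR_ge0.
  by rewrite sq -powRrM; congr (2 `^ _); rewrite natrM; field.
rewrite e /l -[X in expR (X / 2)]exprMn mulfV; last by rewrite gt_eqF.
rewrite expr1n mul1r exprVn invrK -exprM.
by rewrite [leRHS]mulrAC.
Qed.

(** The [p]-th powers of the dyadic increments, weighted so that their sum has finite
    mean, bound all the increments of almost every path at once; a large [p] absorbs
    the number of points of each level. *)
Lemma ae_growth_right :
  {ae P, forall w, exists2 C, 0 <= C & forall x, 0 <= x ->
    `|b x w - b 0 w| <= C * (1 + x) ^+ 3}.
Proof.
have p2 m : 0 < 2 ^+ m :> R by rewrite exprn_gt0.
(* At the points k / 2 ^ n the weights below cost a factor 2 * 4 ^ n * (1 + k / 2 ^ n) ^ 2,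
   and theta ^ p absorbs the 4. *)
have [p p0 tp] : exists2 p, (0 < p)%N & 4 * theta ^+ p <= 1.
  have c : (fun n => theta ^+ n) @ \oo --> (0 : R).
    by apply: cvg_expr; rewrite ger0_norm ?ltW.
  move/cvgrPdist_le : c => /(_ (4^-1)); rewrite invr_gt0 ltr0n => /(_ isT).
  move=> [N _ HN]; exists N.+1 => //; have := HN N.+1 (leqnSn N).
  by rewrite /= sub0r normrN ger0_norm ?exprn_ge0 ?(ltW theta_gt0)// -ler_pdivlMl ?mulr1.
pose d n k w := `|b (k.+1%:R / 2 ^+ n) w - b (k%:R / 2 ^+ n) w|.
have d0 n k w : 0 <= d n k w by exact: normr_ge0.
(* The series of 1 / ((k + 1) * (k + 2)) telescopes to 1. *)
pose c n k := (theta ^+ (2 * n * p))^-1 * (k.+1%:R * k.+2%:R)^-1 : R.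
have c0 n k : 0 < c n k by rewrite mulr_gt0// invr_gt0 ?mulr_gt0 ?exprn_gt0.
pose Q n k w := (c n k * d n k w ^+ p)%:E.
have Q0 n k w : (0 <= Q n k w)%E by rewrite lee_fin mulr_ge0 ?(ltW (c0 _ _)) ?exprn_ge0.
have md n k : measurable_fun setT (fun w => d n k w ^+ p).
  apply: measurable_funX; apply: measurableT_comp => //.
  by apply: measurable_funB; exact: (gaussian_space_measurable GX).
have mQ n k : measurable_fun setT (Q n k).
  by apply/measurable_EFinP; apply: measurable_funM.
pose S w := (\sum_(0 <= n <oo) \sum_(0 <= k <oo) Q n k w)%E.
have mSk n : measurable_fun setT (fun w => \sum_(0 <= k <oo) Q n k w)%E.
  by apply: ge0_emeasurable_sum => // k w _ _.
have S1 n w : (0 <= \sum_(0 <= k <oo) Q n k w)%E by exact: nneseries_ge0.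
have mS : measurable_fun setT S by apply: ge0_emeasurable_sum => // n w _ _.
pose K := p`!%:R * (2 * expR 2^-1) : R.
have K0 : 0 <= K by rewrite !mulr_ge0// expR_ge0.
have iQ n k : (\int[P]_w Q n k w <= (K * (theta ^+ (2 * p)) ^+ n * (k.+1%:R * k.+2%:R)^-1)%:E)%E.
  have id : P.-integrable setT (EFin \o (fun w => d n k w ^+ p)).
    have Gd : gaussian_space X (fun w => b (k.+1%:R / 2 ^+ n) w - b (k%:R / 2 ^+ n) w).
      exact: gaussian_spaceB.
    have := integrable_norm (gaussian_space_integrableX GX p Gd).
    by apply: eq_integrable => // w _; rewrite /= normrX.
  have idZ := RintegrableZl (c n k) measurableT id.
  rewrite -[leLHS]fineK; last exact: (integrable_fin_num measurableT idZ).
  rewrite lee_fin -[leLHS]/(\int[P]_w (c n k * d n k w ^+ p)) RintegralZl//.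
  apply: (le_trans (ler_wpM2l (ltW (c0 n k)) (incr_moment p n k))).
  rewrite /c -/K le_eqVlt; apply/orP; left; apply/eqP.
  have -> : (4 * n * p = 2 * n * p + 2 * n * p)%N by rewrite -mulnDl -mulnDl.
  rewrite exprD -exprM (_ : (2 * p * n = 2 * n * p)%N); last by rewrite mulnAC.
  have k0 : 0 <= k%:R :> R by [].
  by field; rewrite expf_neq0 ?(gt_eqF theta_gt0)// andbT !gt_eqF//; lra.
have ESfin : (\int[P]_w S w < +oo)%E.
  rewrite integral_nneseries//.
  pose z := theta ^+ (2 * p).
  have z0 : 0 <= z by rewrite exprn_ge0 ?(ltW theta_gt0).
  have z1 : z < 1 by rewrite exprn_ilt1 ?ltW// muln_eq0/= -lt0n.
  apply: (@le_lt_trans _ _ (K * (1 - z)^-1)%:E); last by rewrite ltry.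
  apply: (@le_trans _ _ (\sum_(0 <= n <oo) (K * z ^+ n)%:E)%E).
    apply: lee_nneseries => [n _ _|n _]; first by apply: integral_ge0.
    rewrite integral_nneseries//.
    apply: (@le_trans _ _ (\sum_(0 <= k <oo) (K * z ^+ n * (k.+1%:R * k.+2%:R)^-1)%:E)%E).
      by apply: lee_nneseries => [k _ _|k _]; [exact: integral_ge0|exact: iQ].
    have Kz : 0 <= K * z ^+ n by rewrite mulr_ge0// exprn_ge0.
    apply: nneseries_le_bounded => [k|N].
      by rewrite mulr_ge0// invr_ge0 mulr_ge0.
    rewrite -mulr_sumr -[leRHS]mulr1 ler_wpM2l//.
    have -> : \sum_(0 <= k < N) (k.+1%:R * k.+2%:R)^-1 = 1 - N.+1%:R^-1 :> R.
      elim: N => [|N IHN]; first by rewrite big_geq// invr1 subrr.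
      rewrite big_nat_recr//= IHN -[N.+2%:R]natr1 -[N.+1%:R]natr1.
      have N0 : 0 <= N%:R :> R by [].
      by field; rewrite !gt_eqF//; lra.
    by rewrite gerBl invr_ge0.
  apply: nneseries_le_bounded => [n|N]; first by rewrite mulr_ge0// exprn_ge0.
  by rewrite -mulr_sumr ler_wpM2l// big_mkord sum_geom_le.
have iS : P.-integrable setT S.
  apply/integrableP; split=> //.
  by under eq_integral do rewrite gee0_abs ?nneseries_ge0//.
have := integrable_ae measurableT iS; apply: filterS => w /(_ I) Sfin.
pose s := fine (S w).
have s0 : 0 <= s by apply: fine_ge0; exact: nneseries_ge0.
have Qs n k : c n k * d n k w ^+ p <= s.
  rewrite -lee_fin fineK//.
  apply: (le_trans (nneseries_ge_term k (fun k => Q0 n k w))).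
  exact: (nneseries_ge_term n (fun n => S1 n w)).
pose M := 1 + 2 * s.
have M1 : 1 <= M by rewrite lerDl mulr_ge0.
have M0 : 0 <= M by lra.
have dle n k : d n k w <= M * theta ^+ n * (1 + k%:R / 2 ^+ n) ^+ 2.
  set x := k%:R / 2 ^+ n.
  have x0 : 0 <= x by rewrite divr_ge0// ltW.
  have r0 : 0 <= M * theta ^+ n * (1 + x) ^+ 2.
    by rewrite mulr_ge0 ?exprn_ge0 ?addr_ge0 ?mulr_ge0 ?exprn_ge0 ?(ltW theta_gt0).
  rewrite -(@ler_pXn2r _ p)// ?nnegrE//.
  have tn0 : 0 < theta ^+ (2 * n * p) by rewrite exprn_gt0.
  have h : d n k w ^+ p <= s * (theta ^+ (2 * n * p) * (k.+1%:R * k.+2%:R)).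
    have := Qs n k; rewrite /c -invfM mulrC ler_pdivrMr//.
    by rewrite mulr_gt0// mulr_gt0.
  apply: (le_trans h); rewrite 2!exprMn.
  have kx : k%:R = 2 ^+ n * x by rewrite /x mulrC divfK// gt_eqF.
  have k4 : k.+1%:R * k.+2%:R <= 2 * (4 ^+ n * (1 + x) ^+ 2) :> R.
    have n1 : 1 <= 2 ^+ n :> R by rewrite exprn_ege1// ler1n.
    have -> : 4 ^+ n = (2 ^+ n) ^+ 2 :> R by rewrite -exprM mulnC exprM; congr (_ ^+ n); ring.
    rewrite -natr1 -[k.+2%:R]natr1 -[k.+1%:R]natr1 kx -exprMn mulrDr mulr1.
    set A := 2 ^+ n in n1 *.
    have Ax : 0 <= A * x by rewrite mulr_ge0//; lra.
    by nra.
  have -> : theta ^+ (2 * n * p) = theta ^+ n ^+ p * (theta ^+ p) ^+ n.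
    by rewrite -!exprM -exprD; congr (_ ^+ _); rewrite (mulnC p n) -mulnDl addnn mul2n.
  have t4 : 4 ^+ n * (theta ^+ p) ^+ n <= 1.
    by rewrite -exprMn exprn_ile1// mulr_ge0// exprn_ge0// ltW.
  have tp0 : 0 <= (theta ^+ p) ^+ n by rewrite !exprn_ge0// ltW.
  have tnp0 : 0 <= theta ^+ n ^+ p by rewrite !exprn_ge0// ltW.
  have W1 : 1 <= (1 + x) ^+ 2 by rewrite exprn_ege1// lerDl.
  apply: (@le_trans _ _ (2 * s * theta ^+ n ^+ p * (1 + x) ^+ 2)).
    have -> : s * (theta ^+ n ^+ p * (theta ^+ p) ^+ n * (k.+1%:R * k.+2%:R)) =
      (s * theta ^+ n ^+ p * (theta ^+ p) ^+ n) * (k.+1%:R * k.+2%:R) by ring.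
    apply: (le_trans (ler_wpM2l _ k4)); first by rewrite !mulr_ge0.
    have -> : s * theta ^+ n ^+ p * (theta ^+ p) ^+ n * (2 * (4 ^+ n * (1 + x) ^+ 2)) =
      (2 * s * theta ^+ n ^+ p * (1 + x) ^+ 2) * (4 ^+ n * (theta ^+ p) ^+ n) by ring.
    by rewrite ler_piMr// !mulr_ge0// addr_ge0.
  apply: ler_pM.
  - by rewrite !mulr_ge0.
  - by lra.
  - rewrite ler_wpM2r//; apply: (@le_trans _ _ M); first by rewrite /M; lra.
    by rewrite ler_eXnr.
  - by rewrite ler_eXnr.
have t0 := ltW theta_gt0.
exists (M * (1 + (1 - theta)^-1)).
  by rewrite mulr_ge0// addr_ge0// invr_ge0 subr_ge0 ltW.
by move=> x x0; exact: (chaining_growth (@cb w) M0 t0 theta_lt1 dle).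
Qed.

End path_growth.

(** * Joint measurability and Fubini's theorem *)

(** A function that is continuous in one variable and measurable in the other is
    the limit of its values on finer and finer grids, hence jointly measurable. *)
Lemma measurable_caratheodory (R : realType) d (Omega : measurableType d)
    (f : R -> Omega -> R) :
  (forall w, continuous (f ^~ w)) -> (forall t, measurable_fun setT (f t)) ->
  measurable_fun setT (fun p : measurableTypeR R * Omega => f p.1 p.2).
Proof.
move=> cf mf.
pose u (n : nat) (t : R) : R := (Num.floor (t * n.+1%:R))%:~R / n.+1%:R.
have n0 n : 0 < n.+1%:R :> R by [].
apply: (@measurable_fun_cvg _ _ _ _ (fun n p => f (u n p.1) p.2)) => [n|[t w] _].
- move=> _ Y mY; rewrite setTI.
  pose A (z : int) := (fst @^-1` `[z%:~R / n.+1%:R : R, (z + 1)%:~R / n.+1%:R[) `&`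
    (snd @^-1` ((f (z%:~R / n.+1%:R)) @^-1` Y)) : set (measurableTypeR R * Omega).
  have -> : (fun p : measurableTypeR R * Omega => f (u n p.1) p.2) @^-1` Y =
      \bigcup_z A z.
    apply/seteqP; split=> [[t w] /= Yf|[t w] [z _ []/=]].
      exists (Num.floor (t * n.+1%:R)) => //; split => //=.
      have /andP[fl fu] := real_floor_itv (num_real (t * n.+1%:R)).
      by rewrite in_itv/= ler_pdivrMr// ltr_pdivlMr// fl fu.
    rewrite in_itv/= ler_pdivrMr// ltr_pdivlMr// => tz Yf.
    by rewrite /u (floor_def tz).
  apply: countable_bigcupT_measurable => [|z]; first exact: countableP.
  apply: measurableI.
    by rewrite -[X in measurable X]setTI; apply: measurable_fst => //; exact: measurable_itv.
  rewrite -[X in measurable X]setTI; apply: measurable_snd => //.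
  by rewrite -[X in measurable X]setTI; apply: mf.
- have cu : u n t @[n --> \oo] --> t.
    apply/cvgrPdist_le => /= e e0; near=> n.
    have /andP[fl fu] := real_floor_itv (num_real (t * n.+1%:R)).
    have e1 : n.+1%:R^-1 <= e.
      by rewrite ltW//; near: n; exact: near_infty_natSinv_lt (PosNum e0).
    apply: le_trans e1.
    have -> : t - u n t = (t * n.+1%:R - (Num.floor (t * n.+1%:R))%:~R) / n.+1%:R.
      by rewrite /u; field; rewrite gt_eqF.
    rewrite normrM (ger0_norm (x := _^-1)) ?invr_ge0// ler_piMl ?invr_ge0//.
    rewrite ger0_norm ?subr_ge0// lerBlDl; apply: ltW.
    by rewrite intrD in fu.
  exact: (cvg_comp (u ^~ t) (f ^~ w) cu (cf w t)).
Unshelve. all: by end_near. Qed.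

Section parametric.
Context d1 d2 (T1 : measurableType d1) (T2 : measurableType d2) (R : realType).
Variables (m1 : {sigma_finite_measure set T1 -> \bar R}).
Variables (m2 : {sigma_finite_measure set T2 -> \bar R}).

(** Tonelli's theorem, applied to the positive and to the negative part. *)
Lemma measurable_Rintegral_param (D : set T1) (f : T1 * T2 -> R) :
  measurable D -> measurable_fun setT f ->
  measurable_fun setT (fun y => \int[m1]_(x in D) f (x, y)).
Proof.
move=> mD mf.
pose g p := ((f p * \1_D p.1)%:E : \bar R).
have mg : measurable_fun setT g.
  apply/measurable_EFinP; apply: measurable_funM => //.
  by apply: measurableT_comp => //; exact: measurable_indic.
have -> : (fun y => \int[m1]_(x in D) f (x, y)) =
    fine \o (fun y => (\int[m1]_x g^\+ (x, y) - \int[m1]_x g^\- (x, y))%E).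
  apply/funext => y /=; rewrite /Rintegral; congr fine.
  rewrite integral_mkcond/= (eq_integral (fun x => g (x, y))); last first.
    move=> x _; rewrite /g patchE indicE /=; case: ifPn => _.
      by rewrite mulr1.
    by rewrite mulr0.
  rewrite [LHS]integralE; congr (_ - _)%E.
    by under eq_integral do rewrite funepos_comp/=.
  by under eq_integral do rewrite funeneg_comp/=.
apply: measurableT_comp => //; apply: emeasurable_funB.
  apply: (measurable_fun_fubini_tonelli_G (m1 := m1) (g^\+)%E) => //.
  exact: measurable_funepos.
apply: (measurable_fun_fubini_tonelli_G (m1 := m1) (g^\-)%E) => //.
exact: measurable_funeneg.
Qed.

Lemma Rintegrable_prod (f : T1 -> R) (g : T2 -> R) :
  m1.-integrable setT (EFin \o f) -> m2.-integrable setT (EFin \o g) ->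
  (m1 \x m2)%E.-integrable setT (EFin \o (fun p => f p.1 * g p.2)) /\
  \int[(m1 \x m2)%E]_p (f p.1 * g p.2) = \int[m1]_x f x * \int[m2]_y g y.
Proof.
move=> fi gi.
have mf : measurable_fun setT f by apply/measurable_EFinP; exact: measurable_int fi.
have mg : measurable_fun setT g by apply/measurable_EFinP; exact: measurable_int gi.
have mfg : measurable_fun setT (EFin \o (fun p : T1 * T2 => f p.1 * g p.2)).
  by apply/measurable_EFinP; apply: measurable_funM; apply: measurableT_comp.
have i12 : (m1 \x m2)%E.-integrable setT (EFin \o (fun p => f p.1 * g p.2)).
  apply/integrable12ltyP => //.
  have -> : (\int[m1]_x \int[m2]_y `|(f x * g y)%:E| =
    \int[m1]_x (`|f x|%:E * \int[m2]_y `|g y|%:E))%E.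
    apply: eq_integral => x _; under eq_integral do rewrite /= normrM EFinM.
    rewrite ge0_integralZl//; apply/measurable_EFinP; exact: measurableT_comp.
  have [_ fo] := integrableP _ _ _ fi; have [_ go] := integrableP _ _ _ gi.
  rewrite ge0_integralZr//.
  - by rewrite lte_mul_pinfty// ?integral_ge0// ge0_fin_numE// integral_ge0.
  - by apply/measurable_EFinP; exact: measurableT_comp.
  - exact: integral_ge0.
split=> //; rewrite /Rintegral -[in LHS]integral12_prod_meas1//= /fubini_F/=.
have -> : (\int[m1]_x \int[m2]_y (f x * g y)%:E =
    \int[m1]_x ((f x)%:E * \int[m2]_y (g y)%:E))%E.
  apply: eq_integral => x _; under eq_integral do rewrite EFinM.
  by rewrite integralZl.
have gfin := integrable_fin_num measurableT gi.
rewrite -[(\int[m2]_y (g y)%:E)%E]fineK// integralZr// fineM//.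
exact: integrable_fin_num.
Qed.

End parametric.

Section dominated_fubini.
Context d1 d2 (T : measurableType d1) (Omega : measurableType d2) (R : realType).
Variables (m : {sigma_finite_measure set T -> \bar R}) (P : probability Omega R).
Variables (h : T * Omega -> R) (g : T -> R).
Hypothesis mh : measurable_fun setT h.
Hypothesis gi : m.-integrable setT (EFin \o g).
Hypothesis hg : forall x, (\int[P]_w `|h (x, w)|%:E <= (g x)%:E)%E.

(** An integrable bound on the first absolute moments of the sections makes Fubini's
    theorem available. *)
Lemma dominated_integrable_prod : (m \x P)%E.-integrable setT (EFin \o h).
Proof.
apply/integrable12ltyP; first exact/measurable_EFinP.
have [_ go] := integrableP _ _ _ gi.
apply: le_lt_trans go; apply: ge0_le_integral => //.
- by move=> x _; exact: integral_ge0.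
- apply: (measurable_fun_fubini_tonelli_F (m2 := P) (fun z => `|h z|%:E)) => //.
  by apply/measurable_EFinP; exact: measurableT_comp.
- by apply: measurableT_comp => //; exact: measurable_int gi.
- by move=> x _; apply: (le_trans (hg x)); rewrite lee_fin ler_norm.
Qed.

Lemma ae_integrable_section :
  {ae P, forall w, m.-integrable setT (EFin \o (fun x => h (x, w)))}.
Proof. exact: ae_integrable2 dominated_integrable_prod. Qed.

Lemma integrable_section x : P.-integrable setT (EFin \o (fun w => h (x, w))).
Proof.
apply/integrableP; split.
  by apply/measurable_EFinP; exact: (measurable_fun_pair2 x mh).
by apply: (le_lt_trans (hg x)); rewrite ltry.
Qed.

Lemma Rintegral_fubini :
  (\int[P]_w \int[m]_x (h (x, w))%:E = \int[m]_x (\int[P]_w h (x, w))%:E)%E.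
Proof.
rewrite -(Fubini dominated_integrable_prod)/=; apply: eq_integral => x _.
by rewrite /Rintegral fineK//; exact: integrable_fin_num (integrable_section x).
Qed.

Lemma measurable_integral_section :
  measurable_fun setT (fun w => \int[m]_x (h (x, w))%:E)%E.
Proof. exact: measurable_fubini_G dominated_integrable_prod. Qed.

Lemma integrable_integral_section :
  P.-integrable setT (fun w => \int[m]_x (h (x, w))%:E)%E.
Proof.
have mE : measurable_fun setT (EFin \o h) by exact/measurable_EFinP.
apply/integrableP; split; first exact: measurable_integral_section.
have fin := (integrable21ltyP m P mE).1 dominated_integrable_prod.
apply: le_lt_trans fin.
apply: ge0_le_integral => //.
- by apply: measurableT_comp => //; exact: measurable_integral_section.
- apply: (measurable_fun_fubini_tonelli_G (m1 := m) (fun z => `|(h z)%:E|%E)) => //.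
  exact: measurableT_comp.
- move=> w _; apply: le_abse_integral => //.
  exact: (measurable_fun_pair1 w mE).
Qed.

End dominated_fubini.

Section second_moment.
Context d1 d2 (T : measurableType d1) (Omega : measurableType d2) (R : realType).
Variables (m : probability T R) (P : probability Omega R).
Variables (Th : T * Omega -> R) (g : T -> R).
Hypothesis mTh : measurable_fun setT Th.
Hypothesis gi : m.-integrable setT (EFin \o g).
Hypothesis Th1 : forall x, (\int[P]_w `|Th (x, w)|%:E <= (g x)%:E)%E.
Hypothesis Th2 : forall x y,
  (\int[P]_w `|Th (x, w) * Th (y, w)|%:E <= (g x * g y)%:E)%E.

(** The square of an integral is a double integral, which Fubini's theorem turns
    into the integral of the pair correlations. *)
Lemma second_moment_integral :
  (\int[P]_w ((\int[m]_x Th (x, w)) ^+ 2)%:E =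
   \int[m \x m]_z (\int[P]_w (Th (z.1, w) * Th (z.2, w)))%:E)%E.
Proof.
pose h (zw : (T * T) * Omega) := Th (zw.1.1, zw.2) * Th (zw.1.2, zw.2).
have mh : measurable_fun setT h.
  apply: measurable_funM; apply: measurableT_comp => //;
    apply: measurable_fun_pair => //; exact: measurableT_comp.
have [gg _] := Rintegrable_prod gi gi.
have hg (z : T * T) : (\int[P]_w `|h (z, w)|%:E <= (g z.1 * g z.2)%:E)%E.
  exact: Th2.
pose mm : probability (T * T)%type R := [the probability _ _ of (m \x m)%E].
have F := @Rintegral_fubini _ _ (T * T)%type Omega R mm P h _ mh gg hg.
rewrite -[RHS]F.
apply: ae_eq_integral => //.
- apply/measurable_EFinP; apply: measurable_funX.
  exact: measurable_Rintegral_param.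
- exact: (@measurable_integral_section _ _ (T * T)%type Omega R mm P h _ mh gg hg).
apply: filterS (ae_integrable_section mTh gi Th1) => w iw _ /=.
have [i2 e2] := Rintegrable_prod iw iw.
rewrite expr2 -e2 /Rintegral fineK//.
exact: integrable_fin_num i2.
Qed.

End second_moment.

(** * Riemann-Stieltjes integration by parts *)

Section primitive.
Context {R : realType}.
Notation mu := lebesgue_measure.
Implicit Types (f : R -> R) (a b x y : R).

(** For [x] on either side of [0], one of the two intervals is empty or a point, so
    that the same formula is an antiderivative on the whole line. *)
Definition primitive f x : R :=
  \int[mu]_(u in `[0, x]) f u - \int[mu]_(u in `[x, 0]) f u.

Lemma continuous_itv_integrable f a b : continuous f ->
  mu.-integrable `[a, b] (EFin \o f).
Proof.
move=> cf; apply: continuous_compact_integrable; first exact: segment_compact.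
exact: continuous_subspaceT.
Qed.

Lemma Rintegral_itv_cat f a b c : continuous f -> a <= b -> b <= c ->
  \int[mu]_(u in `[a, c]) f u =
  \int[mu]_(u in `[a, b]) f u + \int[mu]_(u in `[b, c]) f u.
Proof.
move=> cf ab bc; have i1 := continuous_itv_integrable a c cf.
have i2 : mu.-integrable `]b, c] (EFin \o f).
  apply: integrableS i1 => //; apply: subset_itvr.
  by rewrite bnd_simp.
rewrite -(Rintegral_itv_obnd_cbnd i2) -(Rintegral_itvB i1) ?bnd_simp//.
by rewrite addrC subrK.
Qed.

Lemma primitiveE f a x : continuous f -> a <= 0 -> a <= x ->
  primitive f x = \int[mu]_(u in `[a, x]) f u - \int[mu]_(u in `[a, 0]) f u.
Proof.
move=> cf a0 ax; rewrite /primitive; have [x0|x0] := leP 0 x.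
  rewrite (Rintegral_itv_cat cf a0 x0) [RHS]addrAC subrr add0r.
  rewrite -[RHS]subr0; congr (_ - _).
  move: x0; rewrite le_eqVlt => /predU1P[<-|x0].
    by rewrite set_itv1 Rintegral_set1.
  by rewrite set_itv_ge ?Rintegral_set0// bnd_simp -ltNge.
rewrite (Rintegral_itv_cat cf ax (ltW x0)) opprD addrA subrr.
by rewrite (@set_itv_ge _ _ (BLeft 0)) ?Rintegral_set0// bnd_simp -ltNge.
Qed.

Lemma is_derive_primitive f x : continuous f -> is_derive x 1 (primitive f) (f x).
Proof.
move=> cf; pose a := - (`|x| + 1).
have x0 := normr_ge0 x; have nx : - `|x| <= x by rewrite lerNnormlW.
have a0 : a <= 0 by rewrite /a; lra.
have ax : a < x by rewrite /a; lra.
have x1 : x < x + 1 by rewrite ltrDl.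
have [dF F'] := continuous_FTC1_closed x1 (continuous_itv_integrable a (x + 1) cf)
  ax (cf x).
set F := (fun y => _) in dF F'.
have D : is_derive x 1 (fun y => F y - \int[mu]_(u in `[a, 0]) f u) (f x).
  have DF : is_derive x 1 F (f x) by apply: (DeriveDef dF); rewrite -derive1E; exact: F'.
  have := is_deriveB DF (is_derive_cst (\int[mu]_(u in `[a, 0]) f u) x 1).
  by rewrite subr0.
apply: near_eq_is_derive D; near=> y; rewrite (primitiveE (a := a))//.
by apply/ltW; near: y; exact: lt_nbhsr.
Unshelve. all: by end_near. Qed.

Lemma continuous_primitive f : continuous f -> continuous (primitive f).
Proof.
move=> cf x; apply: differentiable_continuous; apply/derivable1_diffP.
exact: (@ex_derive _ _ _ _ _ _ _ (is_derive_primitive x cf)).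
Qed.

Lemma is_derive_continuous f (f1 : R -> R) :
  (forall x, is_derive x 1 f (f1 x)) -> continuous f.
Proof.
move=> df x; apply: differentiable_continuous; apply/derivable1_diffP.
exact: (@ex_derive _ _ _ _ _ _ _ (df x)).
Qed.

Lemma Rintegral_FTC f (F : R -> R) a b : a <= b -> continuous f ->
  (forall x, is_derive x 1 F (f x)) ->
  \int[mu]_(u in `[a, b]) f u = F b - F a.
Proof.
rewrite le_eqVlt => /predU1P[<- _ _|ab cf dF].
  by rewrite set_itv1 Rintegral_set1 subrr.
have cF := is_derive_continuous dF.
rewrite /Rintegral (continuous_FTC2 (F := F) ab)//.
- exact: continuous_subspaceT.
- split=> [x _||]; first exact: (@ex_derive _ _ _ _ _ _ _ (dF x)).
    by apply: cvg_at_right_filter; exact: cF.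
  by apply: cvg_at_left_filter; exact: cF.
- by move=> x _; rewrite derive1E; exact: (@derive_val _ _ _ _ _ _ _ (dF x)).
Qed.

End primitive.

Section riemann_stieltjes_existence.
Context {R : realType}.
Implicit Types (f g F : R -> R) (a b c x y : R).

Lemma segment_unif_continuous g a b e : continuous g -> 0 < e ->
  exists2 delta, 0 < delta & forall x y, a <= x <= b ->
    `|x - y| < delta -> `|g x - g y| < e.
Proof.
move=> cg e0.
have /compact_near_coveringP K := @segment_compact R a b.
pose Q (d x : R) := forall y, `|x - y| < d -> `|g x - g y| < e.
have [] := K R (0^'+) Q _ _.
  move=> x _; have := cg x; move/cvgrPdist_lt => /(_ (e / 2)).
  rewrite divr_gt0// => /(_ isT)/nbhs_ballP[r /= r0 Hr].
  near=> z d => y zy.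
  have xz : ball x (r / 2) z.
    by near: z; apply: nbhsx_ballx; rewrite divr_gt0.
  have dr : d < r / 2 by near: d; apply: nbhs_right_lt; rewrite divr_gt0.
  have xy : ball x r y.
    rewrite /ball/= (le_lt_trans (ler_distD z _ _))// [r]splitr ltrD//.
    exact: lt_trans dr.
  have xz' : ball x r z by apply: le_ball xz; rewrite ler_pdivrMr// ler_peMr ?ler1n// ltW.
  have := ltrD (Hr _ xz') (Hr _ xy); rewrite -splitr; apply: le_lt_trans.
  by rewrite /= (distrC (g x) (g z)); exact: ler_distD.
move=> d /= d0 Hd; exists (d / 2); first by rewrite divr_gt0.
move=> x y xab xy; apply: (Hd (d / 2)) => //=.
- by rewrite sub0r normrN gtr0_norm ?divr_gt0// ltr_pdivrMr// ltr_pMr// ltr1n.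
- by rewrite divr_gt0.
Unshelve. all: by end_near. Qed.

Section integrator.
Variables (f f1 G g : R -> R).
Hypotheses (df : forall x, is_derive x 1 f (f1 x)) (f1_gt0 : forall x, 0 < f1 x).
Hypotheses (cg : continuous g) (dG : forall x, is_derive x 1 G (f1 x * g x)).
Let h x := f x * g x - G x.

Let f_mono x y : x <= y -> f x <= f y.
Proof.
move=> xy; have cf := is_derive_continuous df.
have [c _ fE] := MVT_segment xy (fun z _ => df z) (continuous_subspaceT cf).
by rewrite -subr_ge0 fE mulr_ge0 ?subr_ge0// ltW.
Qed.

(** By Cauchy's mean value theorem the increment of [G] over a cell is a value of
    [g] in that cell times the increment of [f], so Abel summation leaves only the
    oscillation of [g]. *)
Lemma RS_cell_le x y c e : x <= c <= y ->
  (forall u v, x <= u <= y -> x <= v <= y -> `|g u - g v| <= e) ->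
  `|f c * (g y - g x) - (h y - h x)| <= e * (f y - f x).
Proof.
move=> /andP[xc cy] osc; have xy := le_trans xc cy.
move: xy; rewrite le_eqVlt => /predU1P[xy|xy].
  by rewrite xy !subrr !mulr0 subrr normr0.
have cf := is_derive_continuous df; have cG := is_derive_continuous dG.
have [xi] := cauchy_MVT xy (continuous_subspaceT cG) (continuous_subspaceT cf)
  (fun z _ => dG z) (fun z _ => df z) (fun z _ => lt0r_neq0 (f1_gt0 z)).
rewrite in_itv/= => /andP[xxi xiy].
rewrite mulrAC mulfV ?gt_eqF// mul1r => gxi.
have [z zxy fz] := MVT xy (fun z _ => df z) (continuous_subspaceT cf).
have fxy : 0 < f y - f x by rewrite fz mulr_gt0// subr_gt0.
have {gxi} GE : G y - G x = g xi * (f y - f x) by rewrite gxi divfK// gt_eqF.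
have -> : f c * (g y - g x) - (h y - h x) =
   (f y - f c) * (g xi - g y) + (f c - f x) * (g xi - g x).
  have E : G y = G x + g xi * (f y - f x) by rewrite -GE addrC subrK.
  by rewrite /h E; ring.
have fcy : 0 <= f y - f c by rewrite subr_ge0 f_mono.
have fxc : 0 <= f c - f x by rewrite subr_ge0 f_mono.
have xixy : x <= xi <= y by rewrite !ltW.
apply: (le_trans (ler_normD _ _)).
rewrite !normrM (ger0_norm fcy) (ger0_norm fxc).
have h1 : `|g xi - g y| <= e by apply: osc => //; rewrite (ltW xy) lexx.
have h2 : `|g xi - g x| <= e by apply: osc => //; rewrite (ltW xy) lexx.
have := ler_wpM2l fcy h1; have := ler_wpM2l fxc h2; lra.
Qed.

Lemma sum_nth_telescope F a (s : seq R) :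
  \sum_(k < size s) (F (nth a s k) - F (nth a (a :: s) k)) = F (last a s) - F a.
Proof.
rewrite -(big_mkord xpredT (fun k => F (nth a s k) - F (nth a (a :: s) k))).
rewrite (telescope_sumr (fun k => F (nth a (a :: s) k)))//.
by rewrite (nth_last a (a :: s)).
Qed.

(** The comparison of each cell with the increment of [f * g - G] is uniform once the
    mesh is below a modulus of uniform continuity of [g]. *)
Lemma is_RS_integral_by_parts a t : a < t -> is_RS_integral f g a t (h t - h a).
Proof.
move=> at0 e e0.
have fat : 0 <= f t - f a by rewrite subr_ge0 f_mono// ltW.
pose e1 := e / (f t - f a + 1).
have d1 : 0 < f t - f a + 1 by rewrite ltr_wpDl.
have e10 : 0 < e1 by rewrite divr_gt0.
have [delta delta0 osc] := segment_unif_continuous a t cg e10.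
exists delta => // s c sP mesh.
have last_s : last a s = t by case: sP => _ /eqP.
have nthE k : (k < size s)%N -> nth a s k = nth t (a :: s) k.+1.
  by move=> ks /=; exact: set_nth_default.
have nthE' k : (k < size s)%N -> nth a (a :: s) k = nth t (a :: s) k.
  by move=> ks; apply: set_nth_default; rewrite ltnS ltnW.
have -> : h t - h a = \sum_(k < size s) (h (nth a s k) - h (nth a (a :: s) k)).
  by rewrite sum_nth_telescope last_s.
rewrite /RS_sum -sumrB; apply: (le_lt_trans (ler_norm_sum _ _ _)).
apply: (@le_lt_trans _ _
  (\sum_(k < size s) e1 * (f (nth a s k) - f (nth a (a :: s) k)))).
  apply: ler_sum => k _; have ks := ltn_ord k; have [ck meshk] := mesh _ ks.
  apply: RS_cell_le => // u v /andP[u1 u2] /andP[v1 v2]; apply/ltW/osc.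
    apply/andP; split.
      apply: le_trans u1; rewrite nthE'//; apply: itv_partition_nth_ge sP.
      by rewrite ltnS ltnW.
    by apply: (le_trans u2); rewrite nthE//; exact: itv_partition_nth_le sP.
  by apply: le_lt_trans meshk; rewrite ler_norml; lra.
rewrite -mulr_sumr sum_nth_telescope last_s /e1 -mulrA gtr_pMr//.
by rewrite mulrC ltr_pdivrMr// mul1r ltrDl.
Qed.

End integrator.

Lemma fine_itv_partition a t delta : a < t -> 0 < delta ->
  exists2 s, itv_partition a t s & forall k : nat, (k < size s)%N ->
    nth a (a :: s) k <= nth a s k /\ nth a s k - nth a (a :: s) k < delta.
Proof.
move=> at0 d0; pose N := Num.truncn ((t - a) / delta).
have ta : 0 < t - a by rewrite subr_gt0.
pose e := (t - a) / N.+1%:R.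
have e0 : 0 < e by rewrite divr_gt0.
have ed : e < delta.
  rewrite ltr_pdivrMr// mulrC -ltr_pdivrMr//.
  exact: truncnS_gt.
pose s := [seq a + k.+1%:R * e | k <- iota 0 N.+1].
have ss : size s = N.+1 by rewrite size_map size_iota.
have ns k : (k < N.+1)%N -> nth a s k = a + k.+1%:R * e.
  by move=> kN; rewrite (nth_map 0%N) ?size_iota// nth_iota.
have ns' k : (k < N.+1)%N -> nth a (a :: s) k = a + k%:R * e.
  by case: k => [|k] kN; [rewrite /= mul0r addr0|rewrite /= ns// ltnW].
have step k : (k < size s)%N -> nth a s k = nth a (a :: s) k + e.
  by rewrite ss => kN; rewrite ns// ns'// -natr1 mulrDl mul1r addrA.
exists s; last first.
  by move=> k /step ->; rewrite lerDl (ltW e0) addrAC subrr add0r.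
split; first by apply/(pathP a) => k /step ->; rewrite ltrDl.
rewrite -(nth_last a) ss/= ns// /e; apply/eqP.
by rewrite mulrC divfK ?pnatr_eq0// addrC subrK.
Qed.

(** Two values are compared on one subdivision that is fine enough for both. *)
Lemma is_RS_integral_unique (f g : R -> R) a t l1 l2 : a < t ->
  is_RS_integral f g a t l1 -> is_RS_integral f g a t l2 -> l1 = l2.
Proof.
move=> at0 h1 h2; apply/eqP; rewrite -subr_eq0; apply: contraT => l12.
pose e := `|l1 - l2| / 2.
have e0 : 0 < e by rewrite divr_gt0// normr_gt0.
have [d1 d10 H1] := h1 _ e0; have [d2 d20 H2] := h2 _ e0.
have d0 : 0 < Num.min d1 d2 by rewrite lt_min d10.
have [s sP mesh] := fine_itv_partition at0 d0.
pose c k := nth a (a :: s) k.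
have tag k : (k < size s)%N -> nth a (a :: s) k <= c k <= nth a s k.
  by move=> /mesh[le _]; rewrite /c lexx.
have {}H1 : `|RS_sum f g a s c - l1| < e.
  apply: H1 => // k ks; split; first exact: tag.
  by have [_ /lt_le_trans] := mesh k ks; apply; rewrite ge_min lexx.
have {}H2 : `|RS_sum f g a s c - l2| < e.
  apply: H2 => // k ks; split; first exact: tag.
  by have [_ /lt_le_trans] := mesh k ks; apply; rewrite ge_min lexx orbT.
have := ltrD H1 H2; rewrite -splitr distrC.
by move=> /(le_lt_trans (ler_distD _ _ _)); rewrite ltxx.
Qed.

Lemma RS_integralE (f g : R -> R) a t l : a < t ->
  is_RS_integral f g a t l -> RS_integral f g a t = l.
Proof.
move=> at0 hl; apply: (is_RS_integral_unique at0 _ hl).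
by rewrite /RS_integral; case: xgetP => [x _ //|/(_ l)].
Qed.

End riemann_stieltjes_existence.

(** * Ornstein-Uhlenbeck paths *)

Lemma is_derive_expRM (R : realType) (k x : R) :
  is_derive x 1 (fun u => expR (k * u)) (k * expR (k * x)).
Proof.
have d : is_derive x 1 (fun u : R => k * u) k.
  by have := is_deriveZ k (is_derive_id x 1); rewrite -[k *: 1]/(k * 1) mulr1.
have := @is_derive1_comp R expR (fun u => k * u) x _ _ (is_derive_expR (k * x)) d.
by rewrite mulrC.
Qed.

Section ou_path.
Context {R : realType}.
Variables (alpha : R) (b : R -> R).
Hypotheses (alpha_gt0 : 0 < alpha) (cb : continuous b).

(** The integral of [expR (alpha * u)] against [b] from [a] to [t] is the increment of
    this function, by parts. *)
Definition ou_pot (x : R) : R :=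
  expR (alpha * x) * b x - primitive (fun u => alpha * expR (alpha * u) * b u) x.

Let continuous_expRM (k : R) : continuous (fun u : R => expR (k * u)).
Proof. exact: is_derive_continuous (is_derive_expRM k). Qed.

Lemma continuous_ou_integrand : continuous (fun u => alpha * expR (alpha * u) * b u).
Proof.
move=> x; apply: cvgM; last exact: cb.
by apply: cvgM; [exact: cvg_cst|exact: continuous_expRM].
Qed.

Lemma continuous_ou_pot : continuous ou_pot.
Proof.
move=> x; apply: cvgB.
  by apply: cvgM; [exact: continuous_expRM|exact: cb].
by apply: continuous_primitive; exact: continuous_ou_integrand.
Qed.

Let kernelE t u : expR (- alpha * (t - u)) = expR (- alpha * t) * expR (alpha * u).
Proof. by rewrite -expRD; congr expR; ring. Qed.

Lemma RS_integral_ou a t : a < t ->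
  RS_integral (fun u => expR (- alpha * (t - u))) b a t =
  expR (- alpha * t) * (ou_pot t - ou_pot a).
Proof.
move=> at0; apply: RS_integralE => //.
set ca := expR (- alpha * t).
pose G u := ca * primitive (fun u => alpha * expR (alpha * u) * b u) u.
have dk (x : R) : is_derive x 1 (fun u => expR (- alpha * (t - u)))
    (alpha * expR (- alpha * (t - x))).
  rewrite (_ : (fun u => _) = fun u => ca * expR (alpha * u)); last first.
    by apply/funext => u; exact: kernelE.
  by have := is_deriveZ ca (is_derive_expRM alpha x); rewrite kernelE -[_ *: _]/(_ * _) mulrCA.
have dG (x : R) : is_derive x 1 G (alpha * expR (- alpha * (t - x)) * b x).
  have := is_deriveZ ca (is_derive_primitive x continuous_ou_integrand).
  by rewrite kernelE -[_ *: _]/(_ * _) -/ca !mulrA (mulrC ca).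
have := is_RS_integral_by_parts dk _ cb dG at0.
rewrite !kernelE -/ca => /(_ _); rewrite /G /ou_pot.
set L := (X in is_RS_integral _ _ _ _ X); set L' := (X in _ -> is_RS_integral _ _ _ _ X).
have -> : L = L' by rewrite /L /L'; ring.
by apply => x; rewrite mulr_gt0// expR_gt0.
Qed.

Lemma RS_integral_Ny_ou t l : ou_pot x @[x --> -oo] --> l ->
  RS_integral_Ny (fun u => expR (- alpha * (t - u))) b t =
  expR (- alpha * t) * (ou_pot t - l).
Proof.
move=> cl; apply: cvg_lim => //.
have : expR (- alpha * t) * (ou_pot t - ou_pot x) @[x --> -oo] -->
   expR (- alpha * t) * (ou_pot t - l).
  by apply: cvgM; [exact: cvg_cst|apply: cvgB => //; exact: cvg_cst].
apply: cvg_trans; apply: near_eq_cvg.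
exists t; split; first exact: num_real.
by move=> a /RS_integral_ou ->.
Qed.

(** If [ou_pot] has no limit at [-oo] then the improper integral diverges at every
    time and takes the default value of limits, so that the Ornstein-Uhlenbeck path
    is continuous for every outcome. *)
Lemma RS_integral_Ny_ou_dvg t : ~ cvg (ou_pot x @[x --> -oo]) ->
  RS_integral_Ny (fun u => expR (- alpha * (t - u))) b t = point.
Proof.
move=> ncv; apply: dvgP; apply: contra_not ncv => /cvg_ex[/= l cl].
apply/cvg_ex; exists (ou_pot t - expR (alpha * t) * l).
have : ou_pot t - expR (alpha * t) *
   RS_integral (fun u => expR (- alpha * (t - u))) b x t @[x --> -oo] -->
   ou_pot t - expR (alpha * t) * l.
  by apply: cvgB; [exact: cvg_cst|apply: cvgM => //; exact: cvg_cst].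
apply: cvg_trans; apply: near_eq_cvg.
exists t; split; first exact: num_real.
move=> a at0; rewrite RS_integral_ou// mulrA -expRD.
by rewrite (_ : alpha * t + - alpha * t = 0) ?expR0 ?mul1r; ring.
Qed.

Lemma continuous_RS_integral_Ny_ou :
  continuous (fun t => RS_integral_Ny (fun u => expR (- alpha * (t - u))) b t).
Proof.
have [/cvg_ex[/= l cl]|ncv] := pselect (cvg (ou_pot x @[x --> -oo])).
  have -> : (fun t => RS_integral_Ny (fun u => expR (- alpha * (t - u))) b t) =
      fun t => expR (- alpha * t) * (ou_pot t - l).
    by apply/funext => t; exact: RS_integral_Ny_ou.
  move=> t; apply: cvgM; first exact: continuous_expRM.
  by apply: cvgB; [exact: continuous_ou_pot|exact: cvg_cst].
have -> : (fun t => RS_integral_Ny (fun u => expR (- alpha * (t - u))) b t) = cst point.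
  by apply/funext => t; exact: RS_integral_Ny_ou_dvg.
exact: cst_continuous.
Qed.

End ou_path.

Lemma truncn_grid_cvg (R : realType) (x : R) : 0 <= x ->
  (Num.truncn (x * n.+1%:R))%:R / n.+1%:R @[n --> \oo] --> x.
Proof.
move=> x0; apply/cvgrPdist_le => /= e e0; near=> n.
have xn0 : 0 <= x * n.+1%:R by rewrite mulr_ge0.
have /andP[fl fu] := truncn_itv xn0.
have e1 : n.+1%:R^-1 <= e.
  by rewrite ltW//; near: n; exact: near_infty_natSinv_lt (PosNum e0).
apply: le_trans e1; set k := Num.truncn _ in fl fu *.
have -> : x - k%:R / n.+1%:R = (x * n.+1%:R - k%:R) / n.+1%:R.
  by field; rewrite gt_eqF.
rewrite normrM (ger0_norm (x := _^-1)) ?invr_ge0// ler_piMl ?invr_ge0//.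
by rewrite ger0_norm ?subr_ge0// lerBlDl natr1 ltW.
Unshelve. all: by end_near. Qed.

(** For continuous functions, convergence at infinity is Cauchy's criterion over a
    countable dense set of pairs of points, a countable combination of events. *)
Lemma measurable_cvg_Ny (R : realType) d (Omega : measurableType d)
    (h : R -> Omega -> R) :
  (forall w, continuous (h ^~ w)) -> (forall x, measurable_fun setT (h x)) ->
  measurable [set w | cvg (h x w @[x --> -oo])].
Proof.
move=> ch mh.
pose pt (N i j : nat) : R := - (N%:R + i%:R / j.+1%:R).
pose E (k N i j i' j' : nat) :=
  [set w | `|h (pt N i j) w - h (pt N i' j') w| <= k.+1%:R^-1].
have mE k N i j i' j' : measurable (E k N i j i' j').
  have mf : measurable_fun setT (fun w => `|h (pt N i j) w - h (pt N i' j') w|).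
    by apply: measurableT_comp => //; exact: measurable_funB.
  have := mf measurableT (`]-oo, k.+1%:R^-1 : R]%classic) (measurable_itv _).
  by rewrite setTI; congr measurable; apply/seteqP; split=> w /=; rewrite in_itv.
have -> : [set w | cvg (h x w @[x --> -oo])] =
    \bigcap_k \bigcup_N \bigcap_i \bigcap_j \bigcap_i' \bigcap_j' E k N i j i' j'.
  apply/seteqP; split=> [w /= cw k _|w Hw].
    have /cvg_ex[/= l cl] := cw.
    have k0 : 0 < k.+1%:R^-1 / 2 :> R by rewrite divr_gt0.
    move/cvgrPdist_le : cl => /(_ _ k0)[M [_ HM]].
    exists (Num.truncn `|M|).+1 => // i _ j _ i' _ j' _.
    have small i0 j0 : pt (Num.truncn `|M|).+1 i0 j0 < M.
      have a0 : 0 <= i0%:R / j0.+1%:R :> R by rewrite divr_ge0.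
      have M1 : - `|M| <= M by rewrite lerNnormlW.
      apply: lt_le_trans M1; rewrite /pt ltrN2.
      by apply: (lt_le_trans (truncnS_gt _)); rewrite lerDl.
    rewrite /E/= [X in _ <= X]splitr (le_trans (ler_distD l _ _))// lerD//.
      by rewrite distrC; exact: HM.
    exact: HM.
  apply/cauchy_cvgP/cauchy_exP => e e0.
  pose k := Num.truncn e^-1.
  have ke : k.+1%:R^-1 < e.
    by rewrite invf_plt ?posrE// truncnS_gt.
  have [N _ HN] := Hw k I.
  exists (h (- N%:R) w); exists (- N%:R); split; first exact: num_real.
  move=> x xN; rewrite /ball/=; apply: le_lt_trans ke.
  have x0 : 0 <= - x - N%:R by lra.
  pose u n := pt N (Num.truncn ((- x - N%:R) * n.+1%:R)) n.
  have cu : u n @[n --> \oo] --> x.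
    have -> : x = - (N%:R + (- x - N%:R)) by ring.
    apply: cvgN; apply: cvgD; first exact: cvg_cst.
    exact: truncn_grid_cvg.
  have cd : `|h (- N%:R) w - h (u n) w| @[n --> \oo] --> `|h (- N%:R) w - h x w|.
    apply: cvg_norm; apply: cvgB; first exact: cvg_cst.
    exact: (cvg_comp u (h ^~ w) cu (ch w x)).
  rewrite -(cvg_lim _ cd)//; apply: limr_le; first by apply/cvg_ex; eexists; exact: cd.
  apply: nearW => n; have := HN 0%N I 0%N I (Num.truncn ((- x - N%:R) * n.+1%:R)) I n I.
  by rewrite /E/= /pt mul0r addr0.
apply: bigcapT_measurable => k; apply: bigcupT_measurable => N.
by do 4 apply: bigcapT_measurable => ?.
Qed.

Section ou_process.
Context {R : realType} d (Omega : measurableType d).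
Variables (alpha : R) (B : R -> Omega -> R).
Hypotheses (alpha_gt0 : 0 < alpha).
Hypotheses (cB : forall w, continuous (B ^~ w)).
Hypothesis mB : forall t, measurable_fun setT (B t).

Lemma measurable_ou_pot x : measurable_fun setT (fun w => ou_pot alpha (B ^~ w) x).
Proof.
have mJ : measurable_fun setT (fun p : measurableTypeR R * Omega =>
    alpha * expR (alpha * p.1) * B p.1 p.2).
  apply: measurable_funM; last exact: measurable_caratheodory.
  apply: measurable_funM => //; apply: measurableT_comp => //.
  by apply: measurable_funM => //; exact: measurable_fst.
apply: measurable_funB; first exact: measurable_funM.
apply: measurable_funB.
  exact: (measurable_Rintegral_param lebesgue_measure (measurable_itv _) mJ).
exact: (measurable_Rintegral_param lebesgue_measure (measurable_itv _) mJ).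
Qed.

(** On the event of convergence the integral is a limit along the negative integers;
    on the complement it is constant. *)
Lemma measurable_RS_integral_Ny_ou t : measurable_fun setT (fun w =>
  RS_integral_Ny (fun u => expR (- alpha * (t - u))) (fun u => B u w) t).
Proof.
pose h x w := ou_pot alpha (B ^~ w) x.
pose G := [set w | cvg (h x w @[x --> -oo])].
have mG : measurable G.
  apply: measurable_cvg_Ny; last exact: measurable_ou_pot.
  by move=> w; exact: continuous_ou_pot.
pose F n w := \1_G w * (expR (- alpha * t) * (h t w - h (- n%:R) w)) +
  (1 - \1_G w) * (point : R).
apply: (@measurable_fun_cvg _ _ _ _ F) => [n|w _].
  have mi : measurable_fun setT (\1_G : Omega -> R) by exact: measurable_indic.
  apply: measurable_funD; apply: measurable_funM => //.
    apply: measurable_funM => //.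
    by apply: measurable_funB; exact: measurable_ou_pot.
  exact: measurable_funB.
have [/cvg_ex[/= l cl]|ncv] := pselect (G w).
  rewrite (RS_integral_Ny_ou alpha_gt0 (@cB w) t cl).
  have wG : G w by apply/cvg_ex; exists l.
  have -> : (fun n => F n w) = fun n => expR (- alpha * t) * (h t w - h (- n%:R) w).
    by apply/funext => n; rewrite /F indicE mem_set// mul1r subrr mul0r addr0.
  apply: cvgM; first exact: cvg_cst.
  apply: cvgB; first exact: cvg_cst.
  move/cvg_ninftyP : cl; apply.
  by apply: (cvg_comp _ _ cvgr_idn); rewrite ninfty.
rewrite (RS_integral_Ny_ou_dvg alpha_gt0 (@cB w) t ncv).
have -> : (fun n => F n w) = cst (point : R).
  apply/funext => n; rewrite /F indicE memNset// mul0r add0r subr0.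
  by rewrite mul1r.
exact: cvg_cst.
Qed.

End ou_process.

(** * Ornstein-Uhlenbeck values as means of increments *)

Lemma Rintegral_dominated_cvg d (T : measurableType d) (R : realType)
    (mu : {measure set T -> \bar R}) (f_ : nat -> T -> R) (f g : T -> R) :
  (forall n, measurable_fun setT (f_ n)) -> measurable_fun setT f ->
  {ae mu, forall x, f_ ^~ x @ \oo --> f x} ->
  mu.-integrable setT (EFin \o g) -> (forall n x, `|f_ n x| <= g x) ->
  \int[mu]_x f_ n x @[n --> \oo] --> \int[mu]_x f x.
Proof.
move=> mf_ mf f_f gi f_g.
have mE (h : T -> R) : measurable_fun setT h -> measurable_fun setT (EFin \o h).
  by move=> mh; exact/measurable_EFinP.
have cE : {ae mu, forall x, setT x -> (fun n => (f_ n x)%:E) @ \oo --> (f x)%:E}.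
  apply: filterS f_f => x h _; apply: cvg_EFin; first exact: nearW.
  exact: h.
have gE : {ae mu, forall x n, setT x -> (`|(f_ n x)%:E| <= (g x)%:E)%E}.
  by apply: aeW => x n _; rewrite /= lee_fin.
have [fi _ c] := dominated_convergence measurableT (fun n => mE _ (mf_ n))
  (mE _ mf) cE gi gE.
apply: fine_cvg; rewrite /Rintegral fineK; first exact: c.
exact: integrable_fin_num.
Qed.

Section exponential_law.
Context {R : realType} (a : R) (a_gt0 : 0 < a).
Notation mu := (@lebesgue_measure R).

(** The probability structure of [exponential_prob a] depends on the proof that [a] is
    positive, which is why it is named here. *)
Definition exp_law : probability (measurableTypeR R) R :=
  exponential_distribution_exponential_prob__canonical__probability_measure_Probability
    a_gt0.

Lemma integral_exp_law (f : R -> R) : exp_law.-integrable setT (EFin \o f) ->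
  \int[exp_law]_x f x = \int[mu]_x (f x * exponential_pdf a x).
Proof.
move=> fi; congr fine.
exact: (integral_density (integrable_exponential_pdf a_gt0) _ fi).
Qed.

(** Powers are dominated by [expR (a / 2 * |x|)], which turns the density of rate [a]
    into a multiple of the density of rate [a / 2]. *)
Lemma integrable_exp_lawX n :
  exp_law.-integrable setT (EFin \o (fun x : R => (1 + `|x|) ^+ n)).
Proof.
have a20 : 0 < a / 2 by rewrite divr_gt0.
pose K := n`!%:R / (a / 2) ^+ n * 2 * expR (a / 2).
have K0 : 0 <= K by rewrite !mulr_ge0 ?invr_ge0 ?exprn_ge0 ?expR_ge0// ltW.
have pE x : K * expR (a / 2 * `|x|) * exponential_pdf a x = 2 * K * exponential_pdf (a / 2) x.
  have [x0|x0] := ltP x 0; first by rewrite !lt0_exponential_pdf// !mulr0.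
  rewrite !exponential_pdfE// (ger0_norm x0).
  have -> : expR (- (a / 2) * x) = expR (a / 2 * x) * expR (- a * x).
    by rewrite -expRD; congr expR; field.
  by field.
apply: (@le_Rintegrable _ _ _ exp_law _ _ (fun x : R => K * expR (a / 2 * `|x|))) => //.
- apply: measurable_funX; apply: measurable_funD => //; exact: measurableT_comp.
- move=> x _; rewrite ger0_norm ?exprn_ge0 ?addr_ge0//.
  have x1 : 0 <= 1 + `|x| by rewrite addr_ge0.
  have := normX_le_expR (1 + `|x|) n a20; rewrite (ger0_norm x1) => h.
  apply: (le_trans h).
  have e2 : expR (a / 2) * expR (a / 2 * `|x|) = expR (a / 2 * (1 + `|x|)).
    by rewrite -expRD mulrDr mulr1.
  have le : expR (- (a / 2) * (1 + `|x|)) <= expR (a / 2 * (1 + `|x|)).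
    rewrite ler_expR mulNr; have : 0 <= a / 2 * (1 + `|x|) by rewrite mulr_ge0// ltW.
    by lra.
  have -> : K * expR (a / 2 * `|x|) =
      n`!%:R / (a / 2) ^+ n * (2 * expR (a / 2 * (1 + `|x|))).
    by rewrite -e2 /K; ring.
  apply: ler_wpM2l; last by lra.
  by rewrite mulr_ge0// invr_ge0 exprn_ge0// ltW.
have mE : measurable_fun setT (fun x : measurableTypeR R => K * expR (a / 2 * `|x|)).
  apply: measurable_funM => //; apply: measurableT_comp => //.
  by apply: measurable_funM => //; exact: measurableT_comp.
apply/integrableP; split; first by apply/measurable_EFinP; exact: mE.
rewrite (eq_integral (fun x : measurableTypeR R => (K * expR (a / 2 * `|x|))%:E)); last first.
  by move=> x _; rewrite /= ger0_norm// mulr_ge0// expR_ge0.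
rewrite (ge0_integral_density (integrable_exponential_pdf a_gt0))//.
- under eq_integral => x _ do rewrite -EFinM pE EFinM.
  rewrite ge0_integralZl//.
  + by rewrite integral_exponential_pdf// mule1 ltry.
  + by apply/measurable_EFinP; apply: measurable_exponential_pdf.
  + by move=> x _; rewrite lee_fin exponential_pdf_ge0// ltW.
  + by rewrite lee_fin mulr_ge0.
- by apply/measurable_EFinP; exact: mE.
- by move=> x; rewrite lee_fin mulr_ge0// expR_ge0.
Qed.

End exponential_law.

Section ou_representation.
Context {R : realType} (alpha : R) (alpha_gt0 : 0 < alpha) (b : R -> R) (C : R).
Notation mu := (@lebesgue_measure R).
Hypotheses (cb : continuous b) (C0 : 0 <= C).
Hypothesis growth : forall x, `|b x| <= C * (1 + `|x|) ^+ 3.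

Lemma increment_growth t v :
  `|b t - b (t - v)| <= 2 * C * (1 + `|t|) ^+ 3 * (1 + `|v|) ^+ 3.
Proof.
have [t0 v0] : 0 <= `|t| /\ 0 <= `|v| by [].
have T1 : 1 <= (1 + `|t|) ^+ 3 by rewrite exprn_ege1// lerDl.
have V1 : 1 <= (1 + `|v|) ^+ 3 by rewrite exprn_ege1// lerDl.
have h1 : `|b t| <= C * ((1 + `|t|) ^+ 3 * (1 + `|v|) ^+ 3).
  apply: (le_trans (growth t)); rewrite ler_wpM2l// ler_peMr//.
have h2 : `|b (t - v)| <= C * ((1 + `|t|) ^+ 3 * (1 + `|v|) ^+ 3).
  apply: (le_trans (growth (t - v))); rewrite ler_wpM2l// -exprMn.
  rewrite ler_pXn2r ?nnegrE ?mulr_ge0 ?addr_ge0//.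
  have := ler_normB t v; have : 0 <= `|t| * `|v| by rewrite mulr_ge0.
  by lra.
apply: (le_trans (ler_normB _ _)); lra.
Qed.

Lemma measurable_increment t : measurable_fun setT (fun v : R => b t - b (t - v)).
Proof.
apply: measurable_funB => //; apply: measurableT_comp.
  exact: continuous_measurable_fun.
exact: measurable_funB.
Qed.

Lemma integrable_increment t :
  (exp_law alpha_gt0).-integrable setT (EFin \o (fun v : R => b t - b (t - v))).
Proof.
apply: (@le_Rintegrable _ _ _ (exp_law alpha_gt0) _ _
  (fun v : R => 2 * C * (1 + `|t|) ^+ 3 * (1 + `|v|) ^+ 3)) => //.
- exact: measurable_increment.
- by move=> v _; exact: increment_growth.
- by apply: RintegrableZl => //; exact: integrable_exp_lawX.
Qed.

(** Integration by parts against the exponential density: the antiderivative only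
    involves a primitive of [b], and the boundary term at [x] becomes negligible. *)
Lemma truncated_ou_integral t x : 0 <= x ->
  \int[mu]_(v in `[0, x]) ((b t - b (t - v)) * (alpha * expR (- alpha * v))) =
  expR (- alpha * t) * (ou_pot alpha b t - ou_pot alpha b (t - x))
  - expR (- alpha * x) * (b t - b (t - x)).
Proof.
move=> x0; pose phi u := alpha * expR (alpha * u) * b u.
have cphi : continuous phi by exact: continuous_ou_integrand.
pose F (v : R) := - b t * expR (- alpha * v) + expR (- alpha * t) * primitive phi (t - v).
have cE (k : R) : continuous (fun u : R => expR (k * u)).
  exact: is_derive_continuous (is_derive_expRM k).
have cD : continuous (fun v : R => b (t - v)).
  move=> v; apply: (@continuous_comp _ _ _ (fun v : R => t - v) b); last exact: cb.
  by apply: cvgB; [exact: cvg_cst|exact: cvg_id].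
have cf : continuous (fun v => (b t - b (t - v)) * (alpha * expR (- alpha * v))).
  move=> v; apply: cvgM.
    apply: cvgB; first exact: cvg_cst.
    exact: cD.
  by apply: cvgM; [exact: cvg_cst|exact: cE].
have dF (v : R) : is_derive v 1 F ((b t - b (t - v)) * (alpha * expR (- alpha * v))).
  have d1 := is_deriveZ (- b t) (is_derive_expRM (- alpha) v).
  have dtv : is_derive v 1 (fun v : R => t - v) (-1).
    by have := is_deriveB (is_derive_cst t v 1) (is_derive_id v 1); rewrite sub0r.
  have dp := @is_derive1_comp R _ _ v _ _ (is_derive_primitive (t - v) cphi) dtv.
  have d2 := is_deriveZ (expR (- alpha * t)) dp.
  apply: (is_derive_eq (is_deriveD d1 d2)).
  rewrite -![_ *: _]/(_ * _) /phi.
  have -> : expR (- alpha * v) = expR (- alpha * t) * expR (alpha * (t - v)).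
    by rewrite -expRD; congr expR; ring.
  by ring.
rewrite (Rintegral_FTC x0 cf dF) /F /ou_pot -/phi subr0 mulr0 expR0.
have E1 : expR (- alpha * t) * expR (alpha * t) = 1.
  by rewrite -expRD (_ : _ + _ = 0) ?expR0//; ring.
have E2 : expR (- alpha * t) * expR (alpha * (t - x)) = expR (- alpha * x).
  by rewrite -expRD; congr expR; ring.
set p := expR (- alpha * t) in E1 E2 *; set q := expR (alpha * t) in E1 *.
set r := expR (alpha * (t - x)) in E2 *; set s := expR (- alpha * x) in E2 *.
set G1 := primitive phi t; set G2 := primitive phi (t - x).
rewrite [RHS](_ : _ = (p * q) * b t - p * G1 - (p * r) * b (t - x) + p * G2
  - s * (b t - b (t - x))); last by ring.
by rewrite E1 E2; ring.
Qed.

Lemma increment_vanish t (u : nat -> R) : u n @[n --> \oo] --> +oo ->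
  expR (- alpha * u n) * (b t - b (t - u n)) @[n --> \oo] --> 0.
Proof.
move=> uy; have a20 : 0 < alpha / 2 by rewrite divr_gt0.
pose K := 2 * C * (1 + `|t|) ^+ 3 * (3`!%:R / (alpha / 2) ^+ 3 * 2 * expR (alpha / 2)).
have ev : expR (- (alpha / 2 * u n)) @[n --> \oo] --> 0.
  have ku : alpha / 2 * u n @[n --> \oo] --> +oo.
    apply/cvgryPge => A; move/cvgryPge : uy => /(_ (A / (alpha / 2))).
    by apply: filterS => n; rewrite ler_pdivrMr// mulrC.
  exact: (cvg_comp _ (fun x : R => expR (- x)) ku (@cvgr_expR R)).
have kv : K * expR (- (alpha / 2 * u n)) @[n --> \oo] --> 0.
  by rewrite -(mulr0 K); apply: cvgM => //; exact: cvg_cst.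
apply/norm_cvg0P; apply: (squeeze_cvgr _ (cvg_cst 0) kv); near=> n.
have u0 : 0 <= u n by near: n; move/cvgryPge : uy; apply.
rewrite /= normr_ge0/= normrM ger0_norm ?expR_ge0//.
have u1 : 0 <= 1 + u n by rewrite addr_ge0.
have := normX_le_expR (1 + u n) 3 a20; rewrite (ger0_norm u1) => h.
have g := increment_growth t (u n); rewrite (ger0_norm u0) in g.
have M0 : 0 <= 2 * C * (1 + `|t|) ^+ 3.
  by rewrite !mulr_ge0// exprn_ge0// addr_ge0.
have e0 := expR_ge0 (- alpha * u n).
apply: (le_trans (ler_wpM2l e0 g)).
have le : expR (- (alpha / 2) * (1 + u n)) <= expR (alpha / 2 * (1 + u n)).
  rewrite ler_expR mulNr; have : 0 <= alpha / 2 * (1 + u n) by rewrite mulr_ge0// ltW.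
  by lra.
have f0 : 0 <= 3`!%:R / (alpha / 2) ^+ 3 :> R.
  by rewrite mulr_ge0// invr_ge0 exprn_ge0// ltW.
have h' : (1 + u n) ^+ 3 <= 3`!%:R / (alpha / 2) ^+ 3 * (2 * expR (alpha / 2 * (1 + u n))).
  by apply: (le_trans h); apply: ler_wpM2l => //; lra.
have := ler_wpM2l e0 (ler_wpM2l M0 h'); move=> /le_trans; apply.
have -> : expR (alpha / 2 * (1 + u n)) = expR (alpha / 2) * expR (alpha / 2 * u n).
  by rewrite -expRD mulrDr mulr1.
have -> : expR (- (alpha / 2 * u n)) = expR (- alpha * u n) * expR (alpha / 2 * u n).
  by rewrite -expRD; congr expR; field.
rewrite /K le_eqVlt; apply/orP; left; apply/eqP; ring.
Unshelve. all: by end_near. Qed.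

(** For paths of polynomial growth the improper Riemann-Stieltjes integral exists,
    and integrating by parts writes it as a mean, under an exponential law, of
    increments of the driving path. *)
Lemma RS_integral_Ny_exp_law t :
  RS_integral_Ny (fun u => expR (- alpha * (t - u))) b t =
  \int[exp_law alpha_gt0]_v (b t - b (t - v)).
Proof.
set J := \int[_]_v _.
have Jcvg (u : nat -> R) : u n @[n --> \oo] --> +oo ->
    expR (- alpha * t) * (ou_pot alpha b t - ou_pot alpha b (t - u n))
      @[n --> \oo] --> J.
  move=> uy.
  pose f_ n (v : R) := (b t - b (t - v)) * \1_`]-oo, u n] v.
  have c1 : \int[exp_law alpha_gt0]_v f_ n v @[n --> \oo] --> J.
    apply: (@Rintegral_dominated_cvg _ _ _ (exp_law alpha_gt0) f_ _
      (fun v : R => 2 * C * (1 + `|t|) ^+ 3 * (1 + `|v|) ^+ 3)).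
    - move=> n; apply: measurable_funM; first exact: measurable_increment.
      exact: measurable_indic.
    - exact: measurable_increment.
    - apply: aeW => v; apply: cvg_near_cst; near=> n.
      rewrite /f_ indicE mem_set ?mulr1//= in_itv/=.
      by near: n; move/cvgryPge : uy; apply.
    - by apply: RintegrableZl => //; exact: integrable_exp_lawX.
    - move=> n v; apply: le_trans (increment_growth t v).
      by rewrite normrM ler_piMr// indicE; case: (_ \in _); rewrite ?normr1 ?normr0.
  rewrite -[J]addr0; apply: cvg_trans (cvgD c1 (increment_vanish t uy)).
  apply: near_eq_cvg; near=> n.
  have u0 : 0 <= u n by near: n; move/cvgryPge : uy; apply.
  rewrite fctE integral_exp_law; last first.
    apply: (@le_Rintegrable _ _ _ (exp_law alpha_gt0) _ _
        (fun v : R => 2 * C * (1 + `|t|) ^+ 3 * (1 + `|v|) ^+ 3)) => //.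
    - apply: measurable_funM; first exact: measurable_increment.
      exact: measurable_indic.
    - move=> v _; apply: le_trans (increment_growth t v).
      by rewrite normrM ler_piMr// indicE; case: (_ \in _); rewrite ?normr1 ?normr0.
    - by apply: RintegrableZl => //; exact: integrable_exp_lawX.
  have := truncated_ou_integral t u0; rewrite Rintegral_mkcond => E.
  rewrite (_ : \int[mu]_v _ = \int[mu]_v
    ((fun v => (b t - b (t - v)) * (alpha * expR (- alpha * v))) \_ `[0, u n]) v); last first.
    apply: eq_Rintegral => v _; rewrite /f_ patchE indicE.
    have [v0|v0] := ltP v 0.
      rewrite lt0_exponential_pdf// mulr0 memNset//= in_itv/= => /andP[].
      by rewrite leNgt v0.
    rewrite exponential_pdfE//; have [vu|vu] := leP v (u n).
      by rewrite !mem_set/= ?mulr1// in_itv/= ?v0.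
    by rewrite !memNset/= ?mulr0 ?mul0r// in_itv/= ?v0 /=; apply/negP; rewrite -ltNge.
  by rewrite [X in X + _ = _]E subrK.
have E1 : expR (alpha * t) * expR (- alpha * t) = 1.
  by rewrite -expRD (_ : _ + _ = 0) ?expR0//; ring.
pose L := ou_pot alpha b t - expR (alpha * t) * J.
have cL : ou_pot alpha b x @[x --> -oo] --> L.
  apply/cvg_ninftyP => u uNy.
  have uy : t - u n @[n --> \oo] --> +oo.
    apply/cvgryPge => A; move/cvgrNyPle : uNy => /(_ (t - A)).
    by apply: filterS => n; lra.
  have : ou_pot alpha b t - expR (alpha * t) * (expR (- alpha * t) *
      (ou_pot alpha b t - ou_pot alpha b (t - (t - u n)))) @[n --> \oo] --> L.
    by apply: cvgB; [exact: cvg_cst|apply: cvgM; [exact: cvg_cst|exact: Jcvg]].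
  apply: cvg_trans; apply: near_eq_cvg; apply: nearW => n.
  by rewrite mulrA E1 mul1r !subKr.
rewrite (RS_integral_Ny_ou alpha_gt0 cb t cL) /L.
by rewrite subKr mulrA [X in X * _]mulrC E1 mul1r.
Unshelve. all: by end_near. Qed.

End ou_representation.

(** * Covariances of increments *)

Section vanishing_secdiff.
Context {R : realType}.
Implicit Types f p : R -> R.

(** Linear functions have no second difference, which disposes of the term
    [rho * |x|] of the case [H i + H j = 1]. *)
Lemma secdiff_affine (k l : R) f p : (forall x, p x = k * f x + l * x) ->
  (forall a b e, 0 < e -> exists M, forall x, M < x -> `|secdiff f a b x| <= e) ->
  (forall a b e, 0 < e -> exists M, forall x, M < x -> `|secdiff p a b x| <= e).
Proof.
move=> pE fv a b e e0; pose K := `|k| + 1.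
have K0 : 0 < K by rewrite ltr_wpDl.
have [M HM] := fv a b _ (divr_gt0 e0 K0); exists M => x /HM.
have -> : secdiff p a b x = k * secdiff f a b x by rewrite /secdiff !pE; ring.
rewrite normrM ler_pdivlMr// => h; apply: le_trans h.
by rewrite mulrC ler_wpM2l// lerDl.
Qed.

End vanishing_secdiff.

Section growth.
Context {dO : measure_display} {Omega : measurableType dO} {R : realType}.
Variable P : probability Omega R.
Variables (J : Type) (X : J -> Omega -> R).
Hypothesis GX : centered_gaussian_process P X.
Variables (b : R -> Omega -> R) (H : R).
Hypotheses (H0 : 0 < H) (Gb : forall t, gaussian_space X (b t)).
Hypothesis cb : forall w, continuous (b ^~ w).
Hypothesis varb : forall x y,
  \int[P]_w ((b x w - b y w) ^+ 2) = `|x - y| `^ (2 * H).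

(** The bound on the right half-line, for the path and for its reflection. *)
Lemma ae_growth : {ae P, forall w, exists2 C, 0 <= C &
  forall x, `|b x w| <= C * (1 + `|x|) ^+ 3}.
Proof.
have R1 := ae_growth_right GX H0 Gb cb varb.
have Gb' t : gaussian_space X (b (- t)) by exact: Gb.
have cb' w : continuous (fun t => b (- t) w).
  move=> x; apply: (@continuous_comp _ _ _ (fun t : R => - t) (b ^~ w)); last exact: cb.
  exact: opp_continuous.
have varb' x y : \int[P]_w ((b (- x) w - b (- y) w) ^+ 2) = `|x - y| `^ (2 * H).
  by rewrite varb opprK addrC distrC.
have R2 := ae_growth_right GX H0 Gb' cb' varb'.
apply: filterS2 R1 R2 => w [C1 C10 h1] [C2 C20 h2].
exists (`|b 0 w| + C1 + C2); first by rewrite !addr_ge0.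
have bound x : 0 <= x -> `|b x w| <= (`|b 0 w| + C1 + C2) * (1 + x) ^+ 3 /\
    `|b (- x) w| <= (`|b 0 w| + C1 + C2) * (1 + x) ^+ 3.
  move=> x0; have W1 : 1 <= (1 + x) ^+ 3 by rewrite exprn_ege1// lerDl.
  have b0 : `|b 0 w| <= `|b 0 w| * (1 + x) ^+ 3 by rewrite ler_peMr.
  have p1 : 0 <= C1 * (1 + x) ^+ 3 by rewrite mulr_ge0// (le_trans ler01).
  have p2 : 0 <= C2 * (1 + x) ^+ 3 by rewrite mulr_ge0// (le_trans ler01).
  have := h1 x x0; have := h2 x x0; rewrite oppr0 => k2 k1.
  have -> : b x w = b 0 w + (b x w - b 0 w) by ring.
  have -> : b (- x) w = b 0 w + (b (- x) w - b 0 w) by ring.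
  by split; apply: (le_trans (ler_normD _ _)); lra.
move=> x; have [x0|x0] := ger0P x; first by have [] := bound x x0.
have nx0 : 0 <= - x by rewrite oppr_ge0 ltW.
by have [_] := bound _ nx0; rewrite opprK.
Qed.

End growth.

Section increments.
Context {dO : measure_display} {Omega : measurableType dO} {R : realType}.
Variable P : probability Omega R.
Variables (d : nat) (H : 'I_d -> R) (rho eta : 'I_d -> 'I_d -> R).
Variable B : 'I_d -> R -> Omega -> R.
Hypothesis H01 : forall i : 'I_d, 0 < H i < 1.
Hypothesis mfbmB : is_mfbm P H B.
Hypothesis varB : forall i : 'I_d, ('V_P[B i 1%R] = 1)%E.
Hypothesis parB : mfbm_parameters P H B rho eta.

Let X (p : 'I_d * R) := B p.1 p.2.
Let GX : centered_gaussian_process P X. Proof. by case: mfbmB. Qed.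
Let C (Y Z : Omega -> R) := \int[P]_w (Y w * Z w).

Lemma mfbm_covE_Rintegral i j t s :
  C (B i t) (B j s) = fine (covariance P (B i t) (B j s)).
Proof.
have E0 k x : fine ('E_P[B k x])%E = 0 by rewrite (GX.2 (k, x)).
rewrite covariance.unlock !E0 expectation.unlock /C /Rintegral; congr fine.
by apply: eq_integral => w _; rewrite /= !fctE /= !subr0.
Qed.

(** The part of the covariance that depends on the lag [s - t] alone: the other
    two terms cancel in the covariance of increments. *)
Definition lag_cov i j (x : R) : R :=
  if i == j then `|x| `^ (2 * H i)
  else if H i + H j == 1 then rho i j * `|x| + eta i j * (x * ln `|x|)
  else (rho i j - sign x * eta i j) * `|x| `^ (H i + H j).

Lemma mfbm_cov_lag i j : exists A A' : R -> R, forall t s,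
  C (B i t) (B j s) = A t + A' s - 2^-1 * lag_cov i j (s - t).
Proof.
have [<-|ij] := eqVneq i j.
  exists (fun t => 2^-1 * `|t| `^ (2 * H i)), (fun s => 2^-1 * `|s| `^ (2 * H i)) => t s.
  rewrite mfbm_covE_Rintegral; case: mfbmB => _ _ /(_ i)[_ ->] _ _.
  by rewrite varB mul1e /= /lag_cov eqxx (distrC t); ring.
have E t s : C (B i t) (B j s) = mfbm_cross_cov (H i + H j) (rho i j) (eta i j) t s.
  by rewrite mfbm_covE_Rintegral (mfbm_covE parB ij).
case: (boolP (H i + H j == 1)) => h1.
  exists (fun t => 2^-1 * (rho i j * `|t| - eta i j * (t * ln `|t|))),
    (fun s => 2^-1 * (rho i j * `|s| + eta i j * (s * ln `|s|))) => t s.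
  by rewrite E /mfbm_cross_cov /lag_cov (negbTE ij) h1; ring.
exists (fun t => 2^-1 * ((rho i j + sign t * eta i j) * `|t| `^ (H i + H j))),
  (fun s => 2^-1 * ((rho i j - sign s * eta i j) * `|s| `^ (H i + H j))) => t s.
by rewrite E /mfbm_cross_cov /lag_cov (negbTE ij) (negbTE h1); ring.
Qed.

(** On each half-line [lag_cov] is a multiple of [x `^ h] with [h < 2], or of
    [x * ln x], up to a linear term. *)
Lemma lag_cov_vanish i j a b e : 0 < e ->
  exists M, forall x, M < `|x| -> `|secdiff (lag_cov i j) a b x| <= e.
Proof.
have [/andP[i0 i1] /andP[j0 j1]] := (H01 i, H01 j).
have pw h k : h < 2 -> forall a b e, 0 < e ->
    exists M, forall x, M < x -> `|secdiff (fun x : R => k * x `^ h) a b x| <= e.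
  move=> h2; apply: (@secdiff_affine _ k 0 (fun x => x `^ h)) => [x|a' b' e'].
    by rewrite mul0r addr0.
  exact: secdiff_powR.
have lg k l : forall a b e, 0 < e ->
    exists M, forall x, M < x -> `|secdiff (fun x : R => k * (x * ln x) + l * x) a b x| <= e.
  by apply: (@secdiff_affine _ k l (fun x => x * ln x)) => //; exact: secdiff_xlnx.
move: a b e; case: (boolP (i == j)) => ij.
  have h2 : 2 * H i < 2 by lra.
  apply: (@secdiff_twosided _ _ (fun x => 1 * x `^ (2 * H i)) (fun x => 1 * x `^ (2 * H i))).
  - by move=> x x0; rewrite /lag_cov ij mul1r gtr0_norm.
  - by move=> x x0; rewrite /lag_cov ij mul1r normrN gtr0_norm.
  - exact: pw.
  - exact: pw.
case: (boolP (H i + H j == 1)) => h1.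
  apply: (@secdiff_twosided _ _ (fun x => eta i j * (x * ln x) + rho i j * x)
    (fun x => - eta i j * (x * ln x) + rho i j * x)).
  - by move=> x x0; rewrite /lag_cov (negbTE ij) h1 gtr0_norm// addrC.
  - by move=> x x0; rewrite /lag_cov (negbTE ij) h1 normrN gtr0_norm//; ring.
  - exact: lg.
  - exact: lg.
have h2 : H i + H j < 2 by lra.
apply: (@secdiff_twosided _ _ (fun x => (rho i j - eta i j) * x `^ (H i + H j))
  (fun x => (rho i j + eta i j) * x `^ (H i + H j))).
- by move=> x x0; rewrite /lag_cov (negbTE ij) (negbTE h1) /sign (ltW x0) mul1r gtr0_norm.
- move=> x x0; rewrite /lag_cov (negbTE ij) (negbTE h1) /sign oppr_ge0 leNgt x0/= normrN gtr0_norm//.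
  by rewrite mulN1r opprK.
- exact: pw.
- exact: pw.
Qed.

Definition incr i (t v : R) (w : Omega) : R := B i t w - B i (t - v) w.

Lemma gaussian_space_B i t : gaussian_space X (B i t).
Proof. exact: (gaussian_space_mem X (i, t)). Qed.

Lemma gaussian_space_incr i t v : gaussian_space X (incr i t v).
Proof. by apply: gaussian_spaceB; exact: gaussian_space_B. Qed.

(** The terms that depend on one of the two times alone cancel in the increments. *)
Lemma incr_cov i j t v s u :
  C (incr i t v) (incr j s u) = - 2^-1 * secdiff (lag_cov i j) v (- u) (s - t).
Proof.
have [A [A' E]] := mfbm_cov_lag i j.
have GB k x := gaussian_space_B k x.
have incrE k x y : incr k x y = fun w => B k x w + -1 * B k (x - y) w.
  by apply/funext => w; rewrite /incr mulN1r.
rewrite !incrE /C (gaussian_cov_linl GX)//; last exact: gaussian_space_lin.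
rewrite !(gaussian_cov_linr GX)// -!/(C _ _) !E /secdiff.
have -> : s - t + v - u = s - u - (t - v) by ring.
have -> : s - t + v = s - (t - v) by ring.
have -> : s - t - u = s - u - t by ring.
by ring.
Qed.

Lemma varB_incr i x y :
  \int[P]_w ((B i x w - B i y w) ^+ 2) = `|x - y| `^ (2 * H i).
Proof.
have /andP[i0 i1] := H01 i.
have := incr_cov i i x (x - y) x (x - y).
rewrite /incr subKr /C => ->; rewrite /secdiff /lag_cov eqxx subrr !add0r.
by rewrite subrr normr0 powR0 ?mulf_neq0 ?gt_eqF// normrN; field.
Qed.

(** All that matters of the variance [|v| `^ (2 * H i)] is a bound by a power of the
    lag that is integrable for exponential laws. *)
Lemma incr_var_le i t v : \int[P]_w (incr i t v w ^+ 2) <= (1 + `|v|) ^+ 2.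
Proof.
have /andP[i0 i1] := H01 i; rewrite /incr varB_incr subKr.
have v1 : 1 <= 1 + `|v| by rewrite lerDl.
apply: (@le_trans _ _ ((1 + `|v|) `^ (2 * H i))).
  by rewrite ge0_ler_powR ?nnegrE ?mulr_ge0 ?addr_ge0 ?lerDr// ltW.
rewrite -powR_mulrn ?addr_ge0// ler_powR//; lra.
Qed.

End increments.

(** * Mean-square convergence of averages *)

Section mean_square.
Context d (Omega : measurableType d) (R : realType) (P : probability Omega R).

Lemma Rintegral_probability_cst (r : R) : \int[P]_w r = r.
Proof.
by rewrite /Rintegral integral_cst//= probability_setT mule1.
Qed.

(** The weighted inequality between arithmetic and geometric means, with weights that
    balance the two bounds. *)
Lemma cauchy_schwarz_le (F G : Omega -> R) a b : 0 < a -> 0 < b ->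
  measurable_fun setT F -> measurable_fun setT G ->
  P.-integrable setT (EFin \o (fun w => F w ^+ 2)) ->
  P.-integrable setT (EFin \o (fun w => G w ^+ 2)) ->
  \int[P]_w (F w ^+ 2) <= a ^+ 2 -> \int[P]_w (G w ^+ 2) <= b ^+ 2 ->
  P.-integrable setT (EFin \o (fun w => F w * G w)) /\
  (\int[P]_w `|F w * G w|%:E <= (a * b)%:E)%E.
Proof.
move=> a0 b0 mF mG iF iG Fa Gb.
pose k := b / (2 * a); pose l := a / (2 * b).
have k0 : 0 < k by rewrite divr_gt0// mulr_gt0.
have l0 : 0 < l by rewrite divr_gt0// mulr_gt0.
have ub w : `|F w * G w| <= k * F w ^+ 2 + l * G w ^+ 2.
  rewrite normrM -(real_normK (num_real (F w))) -(real_normK (num_real (G w))).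
  set x := `|F w|; set y := `|G w|.
  have -> : k * x ^+ 2 + l * y ^+ 2 =
      x * y + (b * x - a * y) ^+ 2 / (2 * a * b).
    by rewrite /k /l; field; rewrite !gt_eqF.
  by rewrite lerDl divr_ge0 ?sqr_ge0// !mulr_ge0// ltW.
have iD : P.-integrable setT (EFin \o (fun w => k * F w ^+ 2 + l * G w ^+ 2)).
  by apply: RintegrableD => //; exact: RintegrableZl.
have iFG : P.-integrable setT (EFin \o (fun w => F w * G w)).
  apply: le_Rintegrable iD => //; exact: measurable_funM.
split=> //.
have iN := integrable_norm iFG.
have -> : (\int[P]_w `|F w * G w|%:E = (\int[P]_w `|F w * G w|)%:E)%E.
  by rewrite /Rintegral fineK//; exact: (integrable_fin_num measurableT iN).
rewrite lee_fin; apply: (le_trans (le_Rintegral measurableT iN iD (fun w _ => ub w))).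
rewrite RintegralD//; [|exact: RintegrableZl..]; rewrite !RintegralZl//.
have -> : a * b = k * a ^+ 2 + l * b ^+ 2 by rewrite /k /l; field; rewrite !gt_eqF.
by rewrite lerD// ler_wpM2l// ltW.
Qed.

Lemma mean_norm_le (F : Omega -> R) a : 0 < a -> measurable_fun setT F ->
  P.-integrable setT (EFin \o (fun w => F w ^+ 2)) ->
  \int[P]_w (F w ^+ 2) <= a ^+ 2 -> (\int[P]_w `|F w|%:E <= a%:E)%E.
Proof.
move=> a0 mF iF Fa.
have i1 : P.-integrable setT (EFin \o (fun w : Omega => 1 ^+ 2 : R)).
  exact: finite_measure_integrable_cst.
have e1 : \int[P]_w (1 ^+ 2 : R) <= 1 ^+ 2 by rewrite Rintegral_probability_cst.
have [_] := cauchy_schwarz_le a0 ltr01 mF (measurable_cst (1 : R)) iF i1 Fa e1.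
by under eq_integral do rewrite /= mulr1; rewrite mulr1.
Qed.

Lemma chebyshev_sqr (F : Omega -> R) e : measurable_fun setT F -> 0 < e ->
  (P [set w | (e <= `|F w|)%R] <= (e ^- 2)%:E * \int[P]_w (F w ^+ 2)%:E)%E.
Proof.
move=> mF e0; have e20 : 0 < e ^+ 2 by rewrite exprn_gt0.
have mF2 : measurable_fun setT (fun w => (F w ^+ 2)%:E).
  by apply/measurable_EFinP; exact: measurable_funX.
have := le_integral_abse P measurableT mF2 e20.
under eq_integral do rewrite gee0_abs ?lee_fin ?sqr_ge0//.
rewrite setTI => h; rewrite -lee_pdivrMl ?invr_gt0// invrK.
apply: le_trans h; rewrite lee_wpmul2l ?lee_fin ?(ltW e20)//.
rewrite le_eqVlt; apply/orP; left; apply/eqP; congr (P _); apply/seteqP; split=> w /=.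
  by move=> h; rewrite lee_fin normrX ler_sqr ?nnegrE// ltW.
by rewrite lee_fin normrX ler_sqr ?nnegrE// ltW.
Qed.

End mean_square.


Section mean_square_vanish.
Context d1 d2 (T : measurableType d1) (Omega : measurableType d2) (R : realType).
Variables (m : probability T R) (P : probability Omega R).
Variables (Th : nat -> T * Omega -> R) (g : T -> R).
Hypothesis mTh : forall n, measurable_fun setT (Th n).
Hypothesis g0 : forall x, 0 < g x.
Hypothesis gi : m.-integrable setT (EFin \o g).
Hypothesis iTh : forall n x,
  P.-integrable setT (EFin \o (fun w => Th n (x, w) ^+ 2)).
Hypothesis Thg : forall n x, \int[P]_w (Th n (x, w) ^+ 2) <= g x ^+ 2.
Hypothesis uncorr : {ae (m \x m)%E, forall z : T * T,
  \int[P]_w (Th n (z.1, w) * Th n (z.2, w)) @[n --> \oo] --> 0}.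

Let mThx n x : measurable_fun setT (fun w => Th n (x, w)).
Proof. exact: (measurable_fun_pair2 x (mTh n)). Qed.

Let Th2 n x y := cauchy_schwarz_le (g0 x) (g0 y) (mThx n x) (mThx n y)
  (iTh n x) (iTh n y) (Thg n x) (Thg n y).

Let Th1 n x : (\int[P]_w `|Th n (x, w)|%:E <= (g x)%:E)%E.
Proof. exact: mean_norm_le. Qed.

(** The second moment of an average is the average of the pair correlations, which
    are dominated by [g x * g y] and vanish for almost every pair. *)
Lemma mean_square_cvg0 :
  (\int[P]_w ((\int[m]_x Th n (x, w)) ^+ 2)%:E @[n --> \oo] --> 0)%E.
Proof.
pose mm : probability (T * T)%type R := [the probability _ _ of (m \x m)%E].
pose K n (z : T * T) := \int[P]_w (Th n (z.1, w) * Th n (z.2, w)).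
have iK n z : P.-integrable setT (EFin \o (fun w => Th n (z.1, w) * Th n (z.2, w))).
  by have [] := Th2 n z.1 z.2.
have Kg n z : `|K n z| <= g z.1 * g z.2.
  apply: (le_trans (le_normr_Rintegral measurableT (iK n z))).
  rewrite -lee_fin /Rintegral fineK; first by have [] := Th2 n z.1 z.2.
  exact: (integrable_fin_num measurableT (integrable_norm (iK n z))).
have mK n : measurable_fun setT (K n).
  apply: (@measurable_Rintegral_param _ _ Omega (T * T)%type R P setT
    (fun p => Th n (p.2.1, p.1) * Th n (p.2.2, p.1))) => //.
  apply: measurable_funM; apply: measurableT_comp => //;
    apply: measurable_fun_pair => //; exact: measurableT_comp.
have [gg _] := Rintegrable_prod gi gi.
have c : \int[mm]_z K n z @[n --> \oo] --> \int[mm]_z (0 : R).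
  apply: (Rintegral_dominated_cvg mK _ uncorr gg Kg); exact: measurable_cst.
have E n : (\int[P]_w ((\int[m]_x Th n (x, w)) ^+ 2)%:E = (\int[mm]_z K n z)%:E)%E.
  rewrite (second_moment_integral (mTh n) gi (Th1 n))=> [|x y]; last by have [] := Th2 n x y.
  have iKm : mm.-integrable setT (EFin \o K n).
    by apply: le_Rintegrable gg => // z _; exact: Kg.
  rewrite /Rintegral fineK; last exact: (integrable_fin_num measurableT iKm).
  apply: eq_integral => z _ /=; rewrite /K /Rintegral fineK//.
  exact: (integrable_fin_num measurableT (iK n z)).
under eq_cvg do rewrite E.
apply: cvg_EFin; first exact: nearW.
by rewrite Rintegral_cst// mul0r in c.
Qed.

End mean_square_vanish.

Section uniform_mean.
Context {R : realType}.
Notation mu := (@lebesgue_measure R).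

Fact ltrN11 : (-1 : R) < 1. Proof. by lra. Qed.

Definition unif_sym : probability (measurableTypeR R) R := uniform_prob ltrN11.

Lemma unif_sym_integrable (f : R -> R) : continuous f ->
  unif_sym.-integrable setT (EFin \o f).
Proof.
move=> cf; have mf : measurable_fun setT f by exact: continuous_measurable_fun.
apply/integrableP; split; first exact/measurable_EFinP.
rewrite /= integral_uniform//; last first.
  by apply/measurable_EFinP; exact: measurableT_comp.
have /integrableP[_ h] := continuous_itv_integrable (-1) 1 cf.
by rewrite lte_mul_pinfty// lee_fin invr_ge0; lra.
Qed.

Lemma unif_sym_mean (f : R -> R) : continuous f ->
  \int[unif_sym]_x f x = 2^-1 * \int[mu]_(x in `[-1, 1]) f x.
Proof.
move=> cf; have fi := unif_sym_integrable cf.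
rewrite -RintegralZl//; last exact: continuous_itv_integrable.
rewrite [RHS]Rintegral_mkcond; congr fine.
rewrite (integral_density (integrable_uniform_pdf ltrN11) _ fi)//.
apply: eq_integral => x _; congr EFin; rewrite patchE /uniform_pdf.
rewrite mem_setE in_itv/=; case: ifP => _; last by rewrite mulr0.
by rewrite mulrC; congr (_^-1 * _); ring.
Qed.

Lemma time_average_unif (f : R -> R) T : continuous f -> 0 < T ->
  (2 * T)^-1 * \int[mu]_(t in `[- T, T]) f t = \int[unif_sym]_r f (T * r).
Proof.
move=> cf T0; have cfT : continuous (fun r => f (T * r)).
  move=> r; apply: (@continuous_comp _ _ _ (fun r : R => T * r) f); last exact: cf.
  exact: mulrl_continuous.
rewrite unif_sym_mean//.
have N11 : (-1 : R) <= 1 by lra.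
have NT : - T <= T by lra.
rewrite (Rintegral_FTC NT cf (fun x => is_derive_primitive x cf)).
have D x : is_derive (x : R) 1 (fun r : R => T^-1 * primitive f (T * r)) (f (T * x)).
  have D1 : is_derive (x : R) 1 (fun r : R => T * r) T.
    by apply: (is_derive_eq (is_deriveZ _ _)); rewrite /GRing.scale/= mulr1.
  have D2 := is_derive1_comp (is_derive_primitive (T * x) cf) D1.
  apply: (is_derive_eq (is_deriveZ T^-1 D2)).
  by rewrite /GRing.scale/= mulrC mulfK// gt_eqF.
rewrite (Rintegral_FTC N11 cfT D) mulr1 mulrN1; field.
by rewrite gt_eqF.
Qed.

End uniform_mean.

(** * Cross-covariance ergodicity *)

Section pair_correlations.
Context {dO : measure_display} {Omega : measurableType dO} {R : realType}.
Variable P : probability Omega R.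
Variables (d : nat) (H alpha : 'I_d -> R) (rho eta : 'I_d -> 'I_d -> R).
Variable B : 'I_d -> R -> Omega -> R.
Hypothesis H01 : forall i : 'I_d, 0 < H i < 1.
Hypothesis alpha_gt0 : forall i : 'I_d, 0 < alpha i.
Hypothesis mfbmB : is_mfbm P H B.
Hypothesis varB : forall i : 'I_d, ('V_P[B i 1%R] = 1)%E.
Hypothesis parB : mfbm_parameters P H B rho eta.
Variables (i j : 'I_d) (tau : R).

Let X (p : 'I_d * R) := B p.1 p.2.
Let GX : centered_gaussian_process P X. Proof. by case: mfbmB. Qed.
Let C (Y Z : Omega -> R) := \int[P]_w (Y w * Z w).
Let L := lag_cov H rho eta.
Let covE k l t v s u : \int[P]_w (incr B k t v w * incr B l s u w) =
  - 2^-1 * secdiff (L k l) v (- u) (s - t).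
Proof. exact: (incr_cov mfbmB varB parB). Qed.

Let G k t v : gaussian_space X (incr B k t v) := gaussian_space_incr B k t v.

(* A sample point is a rescaled time in [-1, 1], followed by one lag for each of the
   two coordinates. *)
Let S : measurableType _ :=
  (measurableTypeR R * (measurableTypeR R * measurableTypeR R))%type.

Definition increment_product (T : R) (p : S * Omega) : R :=
  incr B i (T * p.1.1 + tau) p.1.2.1 p.2 * incr B j (T * p.1.1) p.1.2.2 p.2.
Notation Z := increment_product.

Definition increment_mean (x : S) : R := C (incr B i tau x.2.1) (incr B j 0 x.2.2).
Notation kappa := increment_mean.

(** The factor [2] exceeds the square root of the number [3] of pairings in Isserlis'
    formula. *)
Definition increment_bound (x : S) : R := 2 * ((1 + `|x.2.1|) * (1 + `|x.2.2|)).
Notation g := increment_bound.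

Lemma measurable_increment_product T : measurable_fun setT (Z T).
Proof.
case: mfbmB => _ cB _ _ _.
have mB k t : measurable_fun setT (B k t).
  exact: (gaussian_space_measurable GX (gaussian_space_B B k t)).
have mC k := measurable_caratheodory (cB k) (mB k).
have cmp k (a : S * Omega -> R) : measurable_fun setT a ->
    measurable_fun setT (fun p : S * Omega => B k (a p) p.2).
  move=> ma.
  have mp : measurable_fun setT (fun p : S * Omega => (a p : measurableTypeR R, p.2)).
    exact: (measurable_fun_pair ma measurable_snd).
  exact: (measurableT_comp (mC k) mp).
have m1 : measurable_fun setT (fun p : S * Omega => p.1.1).
  by apply: (@measurableT_comp _ _ _ _ _ _ fst) => //; exact: measurable_fst.
have m2 : measurable_fun setT (fun p : S * Omega => p.1.2).
  by apply: (@measurableT_comp _ _ _ _ _ _ snd) => //; exact: measurable_fst.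
have m21 : measurable_fun setT (fun p : S * Omega => p.1.2.1) by exact: measurableT_comp.
have m22 : measurable_fun setT (fun p : S * Omega => p.1.2.2) by exact: measurableT_comp.
have mT : measurable_fun setT (fun p : S * Omega => T * p.1.1).
  exact: measurable_funM.
have mTt : measurable_fun setT (fun p : S * Omega => T * p.1.1 + tau).
  exact: measurable_funD.
apply: measurable_funM; apply: measurable_funB; apply: cmp => //;
  exact: measurable_funB.
Qed.

Let s1 (v : R) : 0 < 1 + `|v|. Proof. by rewrite ltr_wpDr. Qed.

Lemma increment_bound_ge1 x : 1 <= g x.
Proof.
have -> : g x = 1 + (2 * (`|x.2.1| + `|x.2.2| + `|x.2.1| * `|x.2.2|) + 1).
  by rewrite /g; ring.
by rewrite lerDl addr_ge0// mulr_ge0// !addr_ge0// mulr_ge0.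
Qed.

Lemma increment_product_mean T x :
  P.-integrable setT (EFin \o (fun w => Z T (x, w))) /\
  \int[P]_w Z T (x, w) = kappa x.
Proof.
split; first exact: (gaussian_integrableM GX
    (G i (T * x.1 + tau) x.2.1) (G j (T * x.1) x.2.2)).
by rewrite /Z /kappa /C /= !covE; congr (_ * secdiff _ _ _ _); ring.
Qed.

Lemma increment_product_sqr T x :
  P.-integrable setT (EFin \o (fun w => Z T (x, w) ^+ 2)) /\
  \int[P]_w (Z T (x, w) ^+ 2) <= g x ^+ 2.
Proof.
pose a := incr B i (T * x.1 + tau) x.2.1; pose b := incr B j (T * x.1) x.2.2.
have Ga : gaussian_space X a by exact: G.
have Gb : gaussian_space X b by exact: G.
have [ia E] := wick_sqr GX Ga Gb.
have ZE : (fun w => Z T (x, w) ^+ 2) = fun w => a w ^+ 2 * b w ^+ 2.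
  by apply/funext => w; rewrite /Z exprMn.
rewrite ZE; split=> //; rewrite E.
have aa : C a a <= (1 + `|x.2.1|) ^+ 2.
  by rewrite /C; under eq_Rintegral do rewrite -expr2; exact: (incr_var_le H01 mfbmB varB parB).
have bb : C b b <= (1 + `|x.2.2|) ^+ 2.
  by rewrite /C; under eq_Rintegral do rewrite -expr2; exact: (incr_var_le H01 mfbmB varB parB).
have a0 : 0 <= C a a by apply: Rintegral_ge0 => w _; rewrite -expr2 sqr_ge0.
have b0 : 0 <= C b b by apply: Rintegral_ge0 => w _; rewrite -expr2 sqr_ge0.
have ab : C a b ^+ 2 <= ((1 + `|x.2.1|) * (1 + `|x.2.2|)) ^+ 2.
  have sq (c : Omega -> R) : gaussian_space X c ->
      measurable_fun setT c /\ P.-integrable setT (EFin \o (fun w => c w ^+ 2)).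
    move=> Gc; split; first exact: (gaussian_space_measurable GX Gc).
    exact: (gaussian_space_integrableX GX 2 Gc).
  have [ma i2a] := sq _ Ga; have [mb i2b] := sq _ Gb.
  have [iab] := cauchy_schwarz_le (s1 x.2.1) (s1 x.2.2) ma mb i2a i2b
    (incr_var_le H01 mfbmB varB parB _ _ _) (incr_var_le H01 mfbmB varB parB _ _ _).
  move=> h; rewrite -real_normK ?num_real// ler_sqr ?nnegrE ?mulr_ge0 ?(ltW (s1 _))//.
  apply: (le_trans (le_normr_Rintegral measurableT iab)).
  rewrite -lee_fin /Rintegral fineK//.
  exact: (integrable_fin_num measurableT (integrable_norm iab)).
have aabb := ler_pM a0 b0 aa bb.
rewrite -exprMn in aabb.
rewrite /g exprMn; set q := (_ * _) ^+ 2 in ab aabb *.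
have q0 : 0 <= q by exact: sqr_ge0.
rewrite -!/(C _ _); lra.
Qed.

Definition centered_product T (p : S * Omega) : R := Z T p - kappa p.1.
Notation Th := centered_product.

Lemma measurable_centered_product T : measurable_fun setT (Th T).
Proof.
apply: measurable_funB; first exact: measurable_increment_product.
suff mk : measurable_fun setT kappa by exact: measurableT_comp.
have -> : kappa = fun x => \int[P]_w Z 0 (x, w).
  by apply/funext => x; have [_ ->] := increment_product_mean 0 x.
apply: (@measurable_Rintegral_param _ _ Omega S R P setT (fun p => Z 0 (p.2, p.1))) => //.
apply: measurableT_comp; first exact: measurable_increment_product.
exact: (@measurable_fun_pair _ _ _ _ S Omega snd fst).
Qed.

Lemma centered_product_sqr T x :
  P.-integrable setT (EFin \o (fun w => Th T (x, w) ^+ 2)) /\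
  \int[P]_w (Th T (x, w) ^+ 2) <= g x ^+ 2.
Proof.
have [i1 E1] := increment_product_mean T x.
have [i2 le2] := increment_product_sqr T x.
have i3 : P.-integrable setT (EFin \o (fun w : Omega => kappa x ^+ 2)).
  exact: finite_measure_integrable_cst.
have ThE : (fun w => Th T (x, w) ^+ 2) =
    fun w => Z T (x, w) ^+ 2 + (kappa x ^+ 2 + - (2 * kappa x) * Z T (x, w)).
  by apply/funext => w; rewrite /Th /=; ring.
have i4 := RintegrableZl (- (2 * kappa x)) measurableT i1.
have i5 := RintegrableD measurableT i3 i4.
rewrite ThE; split; first exact: RintegrableD.
rewrite !RintegralD// Rintegral_probability_cst RintegralZl// E1.
have k0 := sqr_ge0 (kappa x).
have -> : - (2 * kappa x) * kappa x = - 2 * kappa x ^+ 2 by ring.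
lra.
Qed.

(** Of the three pairings in Isserlis' formula, the one that stays within [x] and
    within [y] is the product of the means; the other two only see the difference of
    the two times. *)
Lemma pair_correlation T x y :
  \int[P]_w (Th T (x, w) * Th T (y, w)) = 4^-1 *
   (secdiff (L i i) x.2.1 (- y.2.1) (T * (y.1 - x.1)) *
    secdiff (L j j) x.2.2 (- y.2.2) (T * (y.1 - x.1)) +
    secdiff (L i j) x.2.1 (- y.2.2) (T * (y.1 - x.1) - tau) *
    secdiff (L j i) x.2.2 (- y.2.1) (T * (y.1 - x.1) + tau)).
Proof.
have [ix Ex] := increment_product_mean T x.
have [iy Ey] := increment_product_mean T y.
pose a := incr B i (T * x.1 + tau) x.2.1; pose b := incr B j (T * x.1) x.2.2.
pose a' := incr B i (T * y.1 + tau) y.2.1; pose b' := incr B j (T * y.1) y.2.2.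
have [iw W] := wick GX (G _ _ _ : gaussian_space X a) (G _ _ _ : gaussian_space X b)
  (G _ _ _ : gaussian_space X a') (G _ _ _ : gaussian_space X b').
have i3 : P.-integrable setT (EFin \o (fun w : Omega => kappa x * kappa y)).
  exact: finite_measure_integrable_cst.
have E : (fun w => Th T (x, w) * Th T (y, w)) =
    fun w => a w * b w * (a' w * b' w) + (kappa x * kappa y +
      (- kappa y * Z T (x, w) + - kappa x * Z T (y, w))).
  by apply/funext => w; rewrite /Th /Z /a /b /a' /b' /=; ring.
have ix' := RintegrableZl (- kappa y) measurableT ix.
have iy' := RintegrableZl (- kappa x) measurableT iy.
have ixy := RintegrableD measurableT ix' iy'.
have i4 := RintegrableD measurableT i3 ixy.
rewrite E !RintegralD// Rintegral_probability_cst !RintegralZl// Ex Ey.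
rewrite W.
have -> : \int[P]_w (a w * b w) = kappa x by rewrite -Ex.
have -> : \int[P]_w (a' w * b' w) = kappa y by rewrite -Ey.
rewrite !covE.
have -> : T * y.1 + tau - (T * x.1 + tau) = T * (y.1 - x.1) by ring.
have -> : T * y.1 - (T * x.1 + tau) = T * (y.1 - x.1) - tau by ring.
have -> : T * y.1 + tau - T * x.1 = T * (y.1 - x.1) + tau by ring.
have -> : T * y.1 - T * x.1 = T * (y.1 - x.1) by ring.
by rewrite -/L; field.
Qed.

Let lag_cov_cvg0 k l a b (u : nat -> R) : (forall M, \forall n \near \oo, M < `|u n|) ->
  secdiff (L k l) a b (u n) @[n --> \oo] --> 0.
Proof.
move=> uy; apply/cvgrPdist_le => e e0.
have [M HM] := @lag_cov_vanish R d H rho eta H01 k l a b e e0.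
by apply: filterS (uy M) => n /HM; rewrite sub0r normrN.
Qed.

Lemma pair_correlation_cvg0 x y (T_ : nat -> R) : x.1 != y.1 ->
  T_ n @[n --> \oo] --> +oo ->
  \int[P]_w (Th (T_ n) (x, w) * Th (T_ n) (y, w)) @[n --> \oo] --> 0.
Proof.
move=> xy Ty; under eq_cvg do rewrite pair_correlation.
have q0 : 0 < `|y.1 - x.1| by rewrite normr_gt0 subr_eq0 eq_sym.
have far s M : \forall n \near \oo, M < `|T_ n * (y.1 - x.1) + s|.
  have /cvgryPgt/(_ ((`|M| + `|s| + 1) / `|y.1 - x.1|)) := Ty.
  apply: filterS => n; rewrite ltr_pdivrMr// => h.
  have Tn : T_ n <= `|T_ n| by exact: ler_norm.
  have h2 : T_ n * `|y.1 - x.1| <= `|T_ n * (y.1 - x.1)|.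
    by rewrite normrM ler_wpM2r.
  have h3 : `|T_ n * (y.1 - x.1)| <= `|T_ n * (y.1 - x.1) + s| + `|s|.
    rewrite -{1}(addrK s (T_ n * _)); apply: le_trans (ler_normB _ _) _.
    by [].
  have := ler_norm M; lra.
have far0 M : \forall n \near \oo, M < `|T_ n * (y.1 - x.1)|.
  by under eq_near do rewrite -[_ * _]addr0; exact: far.
have c k l a b s : secdiff (L k l) a b (T_ n * (y.1 - x.1) + s) @[n --> \oo] --> 0.
  by apply: lag_cov_cvg0 => M; exact: far.
have c0 k l a b : secdiff (L k l) a b (T_ n * (y.1 - x.1)) @[n --> \oo] --> 0.
  by apply: lag_cov_cvg0 => M; exact: far0.
have := cvgM (cvg_cst (4^-1 : R)) (cvgD
  (cvgM (c0 i i x.2.1 (- y.2.1)) (c0 j j x.2.2 (- y.2.2)))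
  (cvgM (c i j x.2.1 (- y.2.2) (- tau)) (c j i x.2.2 (- y.2.1) tau))).
by rewrite !mul0r addr0 mulr0; apply.
Qed.

Let E2 : probability (measurableTypeR R * measurableTypeR R)%type R :=
  [the probability _ _ of (exp_law (alpha_gt0 i) \x exp_law (alpha_gt0 j))%E].
Let m : probability S R := [the probability _ _ of (unif_sym \x E2)%E].

Lemma unif_sym_point (r : R) : unif_sym [set r] = 0%E.
Proof.
have /null_content_dominatesP D := dominates_uniform_prob (@ltrN11 R).
by apply: D; [exact: measurable_set1 | exact: lebesgue_measure_set1].
Qed.

(** The uniform law has no atoms. *)
Lemma ae_distinct_times : {ae (m \x m)%E, forall z : S * S, z.1.1 != z.2.1}.
Proof.
pose A := [set z : S * S | z.1.1 = z.2.1].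
have m1 : measurable_fun setT (fun z : S * S => z.1.1) by exact: measurableT_comp.
have m2 : measurable_fun setT (fun z : S * S => z.2.1) by exact: measurableT_comp.
have mA : measurable A.
  have -> : A = (fun z : S * S => z.1.1 - z.2.1) @^-1` [set 0].
    apply/seteqP; split => z /=; first by rewrite /A/= => ->; rewrite subrr.
    by move=> /subr0_eq.
  rewrite -[X in measurable X]setTI.
  exact: (measurable_funB m1 m2).
exists A; split => //; last by move=> z /= /negP; rewrite negbK => /eqP.
rewrite /product_measure1; apply: integral0_eq => x _ /=.
have -> : xsection A x = [set x.1] `*` setT.
  apply/seteqP; split => y; rewrite /xsection/= inE /A/=; first by move=> ->.
  by case=> ->.
transitivity ((unif_sym \x E2)%E ([set x.1] `*` setT)); first by [].
by rewrite product_measure1E// [X in (X * _)%E](unif_sym_point x.1) mul0e.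
Qed.

Lemma increment_bound_integrable : m.-integrable setT (EFin \o g).
Proof.
have e1 k := integrable_exp_lawX (alpha_gt0 k) 1.
have [i2 _] := Rintegrable_prod (e1 i) (e1 j).
have i1 : unif_sym.-integrable setT (EFin \o (fun _ : R => 2 : R)).
  exact: finite_measure_integrable_cst.
by have [] := @Rintegrable_prod _ _ _ _ R unif_sym E2 _ _ i1 i2.
Qed.

Lemma centered_mean_square_cvg0 (T_ : nat -> R) : T_ n @[n --> \oo] --> +oo ->
  (\int[P]_w ((\int[m]_x Th (T_ n) (x, w)) ^+ 2)%:E @[n --> \oo] --> 0)%E.
Proof.
move=> Ty; apply: (@mean_square_cvg0 _ _ S Omega R m P (fun n => Th (T_ n)) g).
- by move=> n; exact: measurable_centered_product.
- by move=> x; exact: lt_le_trans (increment_bound_ge1 x).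
- exact: increment_bound_integrable.
- by move=> n x; have [] := centered_product_sqr (T_ n) x.
- by move=> n x; have [] := centered_product_sqr (T_ n) x.
- by apply: filterS ae_distinct_times => z zn; exact: pair_correlation_cvg0.
Qed.

Let cB k w : continuous (B k ^~ w). Proof. by case: mfbmB. Qed.
Let mB k t : measurable_fun setT (B k t).
Proof. exact: (gaussian_space_measurable GX (gaussian_space_B B k t)). Qed.

(** The process with unit volatility. *)
Definition unit_mfou k t w :=
  RS_integral_Ny (fun u => expR (- alpha k * (t - u))) (fun u => B k u w) t.
Notation Y := unit_mfou.

Lemma continuous_unit_mfou k w : continuous (fun t => Y k t w).
Proof. exact: (continuous_RS_integral_Ny_ou (alpha_gt0 k) (@cB k w)). Qed.

Lemma measurable_unit_mfou k t : measurable_fun setT (Y k t).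
Proof. exact: (measurable_RS_integral_Ny_ou (alpha_gt0 k) (@cB k) (mB k)). Qed.

Lemma ae_unit_mfou_mean k : {ae P, forall w, forall t,
  (exp_law (alpha_gt0 k)).-integrable setT (EFin \o (fun v => incr B k t v w)) /\
  Y k t w = \int[exp_law (alpha_gt0 k)]_v incr B k t v w}.
Proof.
have /andP[H0 _] := H01 k.
have growth := ae_growth GX H0 (gaussian_space_B B k) (@cB k)
  (varB_incr H01 mfbmB varB parB k).
apply: filterS growth => w [C0 C00 hC] t.
split; first exact: (integrable_increment _ (@cB k w) C00 hC).
exact: (RS_integral_Ny_exp_law (alpha_gt0 k) (@cB k w) C00 hC).
Qed.

Let Zg T x : (\int[P]_w `|Z T (x, w)|%:E <= (g x)%:E)%E.
Proof.
have [i2 le2] := increment_product_sqr T x.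
apply: mean_norm_le i2 le2; first exact: lt_le_trans (increment_bound_ge1 x).
exact: (measurable_fun_pair2 x (measurable_increment_product T)).
Qed.

(** At a fixed time the mean over the two independent lags of the product of the
    increments factors into the values of the two coordinates. *)
Lemma ae_mean_increment_product T : {ae P, forall w,
  m.-integrable setT (EFin \o (fun x => Z T (x, w))) /\
  \int[m]_x Z T (x, w) = \int[unif_sym]_r (Y i (T * r + tau) w * Y j (T * r) w)}.
Proof.
have iZ := ae_integrable_section (measurable_increment_product T)
  increment_bound_integrable (Zg T).
apply: filterS3 (ae_unit_mfou_mean i) (ae_unit_mfou_mean j) iZ => w Yi Yj iw.
split=> //; congr fine.
transitivity (\int[unif_sym]_r (\int[E2]_y (Z T ((r, y), w))%:E))%E.
  by rewrite -(integral12_prod_meas1 iw).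
apply: eq_integral => r _.
have [i1 ->] := Yi (T * r + tau); have [i2 ->] := Yj (T * r).
have [i12 <-] := Rintegrable_prod i1 i2.
by rewrite /Rintegral fineK//; exact: (integrable_fin_num measurableT i12).
Qed.

Let integrable_kappa : m.-integrable setT (EFin \o kappa).
Proof.
have := integrable_fubini_F (dominated_integrable_prod (measurable_increment_product 0)
  increment_bound_integrable (Zg 0)).
apply: eq_integrable => // x _; have [ix E] := increment_product_mean 0 x.
by rewrite /= -E /fubini_F /Rintegral fineK//; exact: (integrable_fin_num measurableT ix).
Qed.

(** For [T = 0] the rescaled time is immaterial, and the average of the increment
    products is [Y i tau * Y j 0] itself. *)
Lemma expectation_unit_mfou :
  P.-integrable setT (EFin \o (fun w => Y i tau w * Y j 0 w)) /\
  \int[P]_w (Y i tau w * Y j 0 w) = \int[m]_x kappa x.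
Proof.
have mZ := measurable_increment_product 0.
have gi := increment_bound_integrable.
have mYY : measurable_fun setT (EFin \o (fun w => Y i tau w * Y j 0 w)).
  by apply/measurable_EFinP; apply: measurable_funM; exact: measurable_unit_mfou.
have mJ := measurable_integral_section mZ gi (Zg 0).
have aeE : {ae P, forall w,
    (\int[m]_x (Z 0 (x, w))%:E = (Y i tau w * Y j 0 w)%:E)%E}.
  apply: filterS (ae_mean_increment_product 0) => w [iw].
  under [RHS]eq_Rintegral do rewrite !mul0r add0r.
  rewrite Rintegral_probability_cst => <-.
  by rewrite /Rintegral fineK//; exact: (integrable_fin_num measurableT iw).
split.
  apply/integrableP; split=> //.
  have /integrableP[_] := integrable_integral_section mZ gi (Zg 0).
  rewrite (@ae_eq_integral _ _ _ P setT (fun w => `|(Y i tau w * Y j 0 w)%:E|%E))//.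
  - exact: measurableT_comp.
  - exact: measurableT_comp.
  - by apply: filterS aeE => w E _; rewrite /= E.
congr fine; transitivity (\int[P]_w \int[m]_x (Z 0 (x, w))%:E)%E.
  apply: ae_eq_integral => //.
  by apply: filterS aeE => w E _; rewrite /= E.
rewrite (Rintegral_fubini mZ gi (Zg 0)).
by apply: eq_integral => x _; have [_ <-] := increment_product_mean 0 x.
Qed.

Let avg T w := (2 * T)^-1 *
  \int[lebesgue_measure]_(t in `[- T, T]) (Y i (t + tau) w * Y j t w).

Lemma continuous_lagged_product w : continuous (fun t => Y i (t + tau) w * Y j t w).
Proof.
move=> t; apply: cvgM; last exact: continuous_unit_mfou.
apply: (@continuous_comp _ _ _ (fun t : R => t + tau) (fun t => Y i t w)).
  by apply: cvgD; [exact: cvg_id|exact: cvg_cst].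
exact: continuous_unit_mfou.
Qed.

Lemma measurable_unit_time_average T : measurable_fun setT (avg T).
Proof.
apply: measurable_funM => //.
have mYY := measurable_caratheodory continuous_lagged_product (fun t => measurable_funM
  (measurable_unit_mfou i (t + tau)) (measurable_unit_mfou j t)).
exact: (measurable_Rintegral_param lebesgue_measure
  (measurable_itv `[- T, T]) mYY).
Qed.

Lemma unit_time_average_cvg (T_ : nat -> R) : T_ n @[n --> \oo] --> +oo ->
  (\int[P]_w ((avg (T_ n) w - \int[P]_w' (Y i tau w' * Y j 0 w')) ^+ 2)%:E @[n --> \oo] --> 0)%E.
Proof.
move=> Ty; have [_ ->] := expectation_unit_mfou.
apply: cvg_trans (centered_mean_square_cvg0 Ty).
apply: near_eq_cvg; have /cvgryPgt/(_ 0) := Ty; apply: filterS => n Tn.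
apply: ae_eq_integral => //.
- apply/measurable_EFinP; apply: measurable_funX.
  apply: (@measurable_Rintegral_param _ _ S Omega R m setT) => //.
  exact: measurable_centered_product.
- apply/measurable_EFinP; apply: measurable_funX; apply: measurable_funB => //.
  exact: measurable_unit_time_average.
apply: filterS (ae_mean_increment_product (T_ n)) => w [iw E] _ /=.
by rewrite /Th RintegralB// E /avg (time_average_unif (@continuous_lagged_product w) Tn).
Qed.

End pair_correlations.

Theorem lemma2p6 (R : realType) (dO : measure_display)
    (Omega : measurableType dO) (P : probability Omega R)
    (d : nat) (H alpha nu : 'I_d -> R) (rho eta : 'I_d -> 'I_d -> R)
    (B : 'I_d -> R -> Omega -> R)
    (H01 : forall i : 'I_d, 0 < H i < 1)
    (Hn12 : forall i : 'I_d, H i != 2^-1)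
    (alpha_gt0 : forall i : 'I_d, 0 < alpha i)
    (nu_gt0 : forall i : 'I_d, 0 < nu i)
    (mfbmB : is_mfbm P H B)
    (varB : forall i : 'I_d, ('V_P[B i 1%R] = 1)%E)
    (parB : mfbm_parameters P H B rho eta) :
  let Y := mfou alpha nu B in
  forall (tau : R) (i j : 'I_d), i != j ->
    cvg_in_probability P +oo (cross_time_average Y tau i j)
      (fine ('E_P[Y i tau \* Y j 0%R])%E).
Proof.
move=> Y tau i j _; pose N := nu i * nu j.
have N0 : 0 < N by rewrite mulr_gt0.
pose y k := unit_mfou alpha B k.
pose avg T w := (2 * T)^-1 *
  \int[lebesgue_measure]_(t in `[- T, T]) (y i (t + tau) w * y j t w).
pose c := \int[P]_w (y i tau w * y j 0 w).
have avgE T w : cross_time_average Y tau i j T w = N * avg T w.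
  rewrite /cross_time_average /avg mulrCA; congr (_ * _).
  rewrite -RintegralZl//; last first.
    apply: continuous_itv_integrable.
    exact: (continuous_lagged_product alpha_gt0 mfbmB).
  by apply: eq_Rintegral => t _; rewrite /Y /mfou /N /y /unit_mfou; ring.
have mavg T : measurable_fun setT (cross_time_average Y tau i j T).
  have -> : cross_time_average Y tau i j T = fun w => N * avg T w.
    by apply/funext => w; exact: avgE.
  apply: measurable_funM => //.
  exact: (measurable_unit_time_average alpha_gt0 mfbmB).
have [iy _] := expectation_unit_mfou H01 alpha_gt0 mfbmB varB parB i j tau.
have EY : fine ('E_P[Y i tau \* Y j 0%R])%E = N * c.
  rewrite expectation.unlock -RintegralZl// /Rintegral; congr fine.
  by apply: eq_integral => w _; congr EFin; rewrite /Y /mfou /N /y /unit_mfou /=; ring.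
rewrite EY; split=> // e e0; apply/cvge_pinftyP => u uy.
have L2 := unit_time_average_cvg H01 alpha_gt0 mfbmB varB parB i j tau uy.
have mF n : measurable_fun setT (fun w => avg (u n) w - c).
  apply: measurable_funB => //.
  exact: (measurable_unit_time_average alpha_gt0 mfbmB).
have eN : 0 < e / N by rewrite divr_gt0.
have E n : [set w | e <= `|cross_time_average Y tau i j (u n) w - N * c|] =
    [set w | e / N <= `|avg (u n) w - c|].
  apply/seteqP; split => w /=; rewrite avgE -mulrBr normrM (gtr0_norm N0);
    by rewrite ler_pdivrMr// mulrC.
apply: (@squeeze_cvge _ _ _ _ (fun=> 0%E) _
  (fun n => ((e / N) ^- 2)%:E * \int[P]_w ((avg (u n) w - c) ^+ 2)%:E)%E).
- by apply: nearW => n; rewrite E measure_ge0/= (chebyshev_sqr P (mF n) eN).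
- exact: cvg_cst.
- by rewrite -[X in _ --> X](mule0 ((e / N) ^- 2)%:E); apply: cvgeZl.
Qed.
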